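(* Let $G$ be a 3-connected cubic graph without a 3-decomposition that has the minimum number of vertices among all 3-connected cubic graphs without a 3-decomposition. Then $G$ contains none of the following graphs as a subgraph: the triangle, $K_{2,3}$, the Petersen graph with one vertex removed, the claw-square, the twin-house, the domino. In particular: (i) the girth of $G$ is at least 4; (ii) every cycle of length 4, 5 or 6 in $G$ is an induced subgraph of $G$; (iii) for every edge $wx$ of $G$ there is an induced path $v_1v_2v_3v_4v_5v_6$ in $G$ on six vertices with $\{v_3,v_4\}=\{w,x\}$.
   Context: All graphs are finite and simple; cubic means 3-regular. A 3-decomposition of a graph $G$ is a partition of $E(G)$ into the edge sets of a spanning tree, a (possibly empty) 2-regular subgraph, and a (possibly empty) matching. The claw-square is the graph on vertices $a_1,a_2,a_3,a_4,b_1,b_2,b_3,c$ with edges $a_1a_2,a_2a_3,a_3a_4,a_4a_1$, $cb_1,cb_2,cb_3$ and $b_1a_1,b_2a_2,b_3a_3$. The twin-house is the graph on vertices $p_1,\dots,p_6$ with edges $p_1p_2,p_1p_5,p_2p_6,p_5p_3,p_5p_4,p_6p_3,p_6p_4$. The domino is the $2\times 3$ grid graph (two 4-cycles sharing an edge). *)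

(* Defs.v *)
From mathcomp Require Import all_boot.
Set Implicit Arguments. Unset Strict Implicit. Unset Printing Implicit Defensive.

Definition simple_graph (T : finType) (e : rel T) : Prop :=
  symmetric e /\ irreflexive e.

Definition deg (T : finType) (e : rel T) (v : T) : nat := #|[set w | e v w]|.

Definition cubic (T : finType) (e : rel T) : Prop := forall v, deg e v = 3.

Definition induced_rel (T : finType) (e : rel T) (A : {set T}) : rel T :=
  [rel x y | [&& e x y, x \in A & y \in A]].

Definition connected_on (T : finType) (e : rel T) (A : {set T}) : Prop :=
  forall x y, x \in A -> y \in A -> connect (induced_rel e A) x y.

Definition k_connected (k : nat) (T : finType) (e : rel T) : Prop :=
  k < #|T| /\ forall S : {set T}, #|S| < k -> connected_on e (~: S).

Definition is_cycle (T : finType) (e : rel T) (s : seq T) : Prop :=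
  [/\ 3 <= size s, uniq s & cycle e s].

Definition acyclic (T : finType) (e : rel T) : Prop :=
  forall s, ~ is_cycle e s.

(* spanning tree (given by its symmetric edge relation F) *)
Definition spanning_tree (T : finType) (F : rel T) : Prop :=
  (forall x y, connect F x y) /\ acyclic F.

Definition two_regular_sub (T : finType) (F : rel T) : Prop :=
  forall v, deg F v = 0 \/ deg F v = 2.

Definition matching (T : finType) (F : rel T) : Prop :=
  forall v, deg F v <= 1.

Definition three_decomposition (T : finType) (e : rel T) : Prop :=
  exists F1 F2 F3 : rel T,
    [/\ symmetric F1, symmetric F2 & symmetric F3] /\
    (forall x y, F1 x y || F2 x y || F3 x y -> e x y) /\
    (forall x y, e x y ->
       [\/ [&& F1 x y, ~~ F2 x y & ~~ F3 x y],
           [&& ~~ F1 x y, F2 x y & ~~ F3 x y] |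
           [&& ~~ F1 x y, ~~ F2 x y & F3 x y]]) /\
    [/\ spanning_tree F1, two_regular_sub F2 & matching F3].

Definition has_subgraph (U T : finType) (h : rel U) (e : rel T) : Prop :=
  exists f : U -> T, injective f /\ forall x y, h x y -> e (f x) (f y).

Definition graph_of (n : nat) (E : seq (nat * nat)) : rel 'I_n :=
  fun x y => ((val x, val y) \in E) || ((val y, val x) \in E).

Definition triangle : rel 'I_3 := @graph_of 3 [:: (0,1); (1,2); (2,0)].

Definition K23 : rel 'I_5 :=
  @graph_of 5 [:: (0,2); (0,3); (0,4); (1,2); (1,3); (1,4)].

(* Petersen graph: outer 5-cycle 0..4, spokes i -- i+5, inner pentagram *)
Definition petersen : rel 'I_10 :=
  @graph_of 10 [:: (0,1); (1,2); (2,3); (3,4); (4,0);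
                  (0,5); (1,6); (2,7); (3,8); (4,9);
                  (5,7); (7,9); (9,6); (6,8); (8,5)].

(* Petersen graph minus vertex 0 (vertex k of 'I_9 is vertex k+1) *)
Definition petersen_minus_vertex : rel 'I_9 :=
  fun x y => petersen (lift ord0 x) (lift ord0 y).

(* claw-square: a1..a4 = 0..3, b1..b3 = 4..6, c = 7 *)
Definition claw_square : rel 'I_8 :=
  @graph_of 8 [:: (0,1); (1,2); (2,3); (3,0);
                 (7,4); (7,5); (7,6);
                 (4,0); (5,1); (6,2)].

(* twin-house: p1..p6 = 0..5 *)
Definition twin_house : rel 'I_6 :=
  @graph_of 6 [:: (0,1); (0,4); (1,5); (4,2); (4,3); (5,2); (5,3)].

(* domino: 2x3 grid, rows 0 1 2 / 3 4 5 *)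
Definition domino : rel 'I_6 :=
  @graph_of 6 [:: (0,1); (1,2); (3,4); (4,5); (0,3); (1,4); (2,5)].

Definition induced_cycle (T : finType) (e : rel T) (s : seq T) : Prop :=
  forall x y, x \in s -> y \in s -> e x y -> (y == next s x) || (x == next s y).

Definition induced_path (n : nat) (T : finType) (e : rel T) (v : 'I_n -> T) : Prop :=
  injective v /\ forall i j : 'I_n, e (v i) (v j) = ((val i == (val j).+1) || (val j == (val i).+1)).

(* Main.v *)
Require Import Defs.
From mathcomp Require Import all_boot zify.
Set Implicit Arguments. Unset Strict Implicit. Unset Printing Implicit Defensive.

(* A 3-decomposition of a cubic graph amounts to a spanning tree such that every edge outside
   it joins two vertices of equal degree in the tree (1 on the cycles, 2 on the matching), and
   a cubic graph is 3-connected iff all its edge cuts have size at least 3. In a minimal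
   counterexample a forbidden subgraph has three or four outgoing edges; it is replaced by a
   smaller gadget (a vertex, an edge, or a 4-cycle) so that all cuts stay large, and a finite
   check shows that each local state of a balanced tree on the gadget lifts to the original
   subgraph. Here an outgoing edge of matching type may be added to the tree, since its outer
   end has no other edge outside the tree. The domino contracts onto an edge unless the rest
   of the graph has a bridge separating the two rows; then it is replaced by a 4-cycle, and
   the bridge provides the information on outer connectivity needed for lifting. *)

(** * Spanning trees and decompositions *)

(** Nothing is known about the part of a tree outside the replaced subgraph, so lifting must be
    decided from the local part alone. Two facts make this possible. A connected spanning subgraph
    with [#|T| - 1] edges is a tree; so the lifted local part only needs the right number of edges
    and has to join all outer ends that the old local part joined, and cycles are never examined.
    The balance condition compares only the two ends of an edge; so it survives outside as soon as
    every outgoing edge left out of the tree sees the same tree degree at its inner end before and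
    after. Two obstacles surround this check. The smaller graph must be simple, although a gadget
    vertex may carry several outgoing edges whose outer ends coincide; and the forbidden subgraph
    may cover the whole graph, so that nothing is left to glue to. In these cases either a cut is
    too small or the graph is one of a few explicit ones, in which a balanced tree is found by
    search. *)

Definition ecount (T : finType) (F : rel T) : nat := \sum_x \sum_y F x y.

Lemma degE (T : finType) (F : rel T) v : deg F v = \sum_w F v w.
Proof.
rewrite /deg -sum1_card [RHS](bigID (F v)) /= [X in _ = _ + X]big1 ?addn0.
  by apply: eq_big => [w | w]; rewrite ?inE // => ->.
by move=> w /negbTE ->.
Qed.

Lemma next_next_neq (T : eqType) (s : seq T) v :
  3 <= size s -> uniq s -> v \in s -> next s (next s v) != v.
Proof.
move=> s3 us vs; have [i s' ds] := rot_to vs.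
have us' : uniq (rot i s) by rewrite rot_uniq.
rewrite -!(next_rot i us) ds; have : 3 <= size (v :: s') by rewrite -ds size_rot.
rewrite ds in us'; case: s' us' {ds} => [|a [|b s']] //= us' _.
move: us'; rewrite !inE !negb_or => /andP[/and3P[va vb _] _].
by rewrite eqxx [a == v]eq_sym (negbTE va) eqxx eq_sym.
Qed.

Section Trees.
Variables (T : finType) (F : rel T).
Hypotheses (symF : symmetric F) (irrF : irreflexive F).

Section ParentTree.
Variables (r : T) (connF : forall x y, connect F x y).

Let reach n : {set T} :=
  iter n (fun A : {set T} => A :|: [set y | [exists x in A, F x y]]) [set r].

Lemma reach_ex x : exists n, x \in reach n.
Proof.
have /connectP[p] := connF r x.
elim/last_ind: p x => [|p y IH] x /=; first by move=> _ ->; exists 0; rewrite inE.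
rewrite rcons_path last_rcons => /andP[pth Fy] ->.
have [n Hn] := IH _ pth erefl; exists n.+1; rewrite /reach iterS -/(reach n) !inE.
by apply/orP; right; apply/existsP; exists (last r p); rewrite Hn.
Qed.

Let dist x := ex_minn (reach_ex x).

Lemma parent_ex x : x != r -> exists u, F u x && (dist u < dist x).
Proof.
move=> xr; rewrite /(dist x); case: ex_minnP => [[|n]] Hn Hmin.
  by rewrite inE (negbTE xr) in Hn.
move: Hn; rewrite /reach iterS -/(reach n) !inE => /orP[Hn|/existsP[u /andP[un Fux]]].
  by have := Hmin _ Hn; rewrite ltnn.
exists u; rewrite Fux ltnS /dist; case: ex_minnP => m _ Hm; exact: Hm.
Qed.

Let parent x := odflt x [pick u | F u x && (dist u < dist x)].

Lemma parentP x : x != r -> F (parent x) x && (dist (parent x) < dist x).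
Proof.
move=> xr; rewrite /parent; case: pickP => [u //|H].
by have [u] := parent_ex xr; rewrite H.
Qed.

Let P : rel T := fun x y => ((x != r) && (y == parent x)) || ((y != r) && (x == parent y)).

(** [P] links each vertex except [r] to one vertex strictly closer to [r], which gives [#|T| - 1]
    edges. On a cycle, both neighbours of a vertex farthest from [r] would be its parent, against
    [next_next_neq]. *)
Lemma parent_tree :
  exists Q : rel T, [/\ symmetric Q, subrel Q F, forall x y, connect Q x y,
    ecount Q + 2 = 2 * #|T| & acyclic Q].
Proof.
have symP : symmetric P by move=> x y; rewrite /P orbC.
have subP : subrel P F.
  by move=> x y /orP[] /andP[/parentP/andP[H _] /eqP ->] //; rewrite symF.
have distP x y : P x y -> dist x <= dist y -> (y != r) && (x == parent y).
  case/orP => // /andP[/parentP/andP[_ H] /eqP ->].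
  by rewrite leqNgt H.
exists P; split=> //.
- suff toroot x : connect P x r.
    by move=> x y; rewrite (connect_trans (toroot x)) // (sym_connect_sym symP).
  elim: {x}_.+1 {-2}x (ltnSn (dist x)) => // n IH x lexn.
  have [->|xr] := eqVneq x r; first exact: connect0.
  have /andP[_ H] := parentP xr.
  apply: connect_trans (IH (parent x) _); last by lia.
  by apply: connect1; rewrite /P xr eqxx.
- have -> : ecount P = \sum_x \sum_y ((x != r) && (y == parent x))
                     + \sum_x \sum_y ((y != r) && (x == parent y)).
    rewrite -big_split; apply: eq_bigr => x _; rewrite -big_split; apply: eq_bigr => y _ /=.
    rewrite /P; case: andP => // -[xr /eqP ->]; case: andP => // -[pr /eqP px].
    by have := parentP xr; have := parentP pr; rewrite -px; lia.
  rewrite [X in _ + X + 2]exchange_big /=.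
  have H x : \sum_y ((x != r) && (y == parent x) : nat) = (x != r).
    case: (x != r) => /=; last by rewrite big1.
    by rewrite (bigD1 (parent x)) //= eqxx big1 // => y /negbTE ->.
  have H2 : \sum_x (x != r : nat) + 1 = #|T|.
    rewrite -sum1_card (bigD1 r) //= eqxx [RHS](bigD1 r) //= addnC.
    by congr (_ + _); rewrite add0n; apply: eq_bigr => x ->.
  have -> : \sum_x \sum_y ((x != r) && (y == parent x) : nat) = \sum_x (x != r : nat).
    by apply: eq_bigr => x _; exact: H.
  by rewrite -H2; lia.
- move=> s [s3 us cs].
  have s0 : exists v, v \in s by case: s s3 {us cs} => // a s _; exists a; rewrite inE eqxx.
  case: s0 => v0 v0s.
  case: (@arg_maxnP _ v0 (mem s) dist v0s) => v vs vmax.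
  have n1 : next s v = parent v.
    have /distP : P (next s v) v by rewrite symP; exact: next_cycle.
    by move=> /(_ (vmax _ _)); rewrite /= mem_next => /(_ vs) /andP[_ /eqP].
  have n2 : prev s v = parent v.
    have /distP : P (prev s v) v by exact: prev_cycle.
    by move=> /(_ (vmax _ _)); rewrite /= mem_prev => /(_ vs) /andP[_ /eqP].
  have := next_next_neq s3 us vs.
  by rewrite n1 -n2 next_prev // eqxx.
Qed.

End ParentTree.

(** Both directions compare [F] with a spanning tree [Q] inside it: an edge of [F] missing from [Q]
    closes a [Q]-path to a cycle, and equal edge counts leave no room for such an edge. [ecount]
    counts ordered pairs, hence twice [#|T| - 1]. *)
Lemma spanning_treeP : 0 < #|T| ->
  spanning_tree F <-> (forall x y, connect F x y) /\ ecount F + 2 = 2 * #|T|.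
Proof.
case/card_gt0P => r _; split=> -[cF HF]; split=> //;
  have [Q [symQ subQ cQ nQ aQ]] := parent_tree r cF.
- suff FQ : F =2 Q by rewrite -nQ; congr (_ + _); do 2!(apply: eq_bigr => ? _); rewrite FQ.
  move=> x y; apply/idP/idP => [Fxy|]; last exact: subQ.
  have /connectP[p0 pth lst] := cQ x y.
  case/shortenP: pth lst => p pth up _ lst.
  case: p pth up lst => [|a [|b p]] pth up lst.
  + by move: Fxy; rewrite lst /= irrF.
  + by move: pth; rewrite lst /= andbT.
  + case: (HF (x :: a :: b :: p)); split=> //.
    rewrite (cycle_path x) /= -[last b p]/(last x (a :: b :: p)) -lst symF Fxy /=.
    by move: pth; rewrite /= => /and3P[/subQ -> /subQ ->]; apply: sub_path.
- have FQ : F =2 Q.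
    move=> x y; have : \sum_x \sum_y (F x y - Q x y) = 0.
      have : ecount Q + \sum_x \sum_y (F x y - Q x y) = ecount F.
        rewrite -big_split; apply: eq_bigr => u _; rewrite -big_split.
        apply: eq_bigr => v _ /=; case Quv: (Q u v) => //=; last by rewrite subn0.
        by rewrite (subQ _ _ Quv).
      by lia.
    move/eqP; rewrite sum_nat_eq0 => /forallP/(_ x)/implyP/(_ isT).
    rewrite sum_nat_eq0 => /forallP/(_ y)/implyP/(_ isT).
    by have := @subQ x y; case: (F x y); case: (Q x y) => // /(_ isT).
  by move=> s [s3 us]; rewrite (eq_cycle FQ) => cs; case: (aQ s).
Qed.

End Trees.

(** The cycles and the matching stay implicit, since tree degrees recover them. The edge count
    stands in for acyclicity because a local replacement changes it by a known amount. *)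
Definition balanced_tree (T : finType) (e F : rel T) : Prop :=
  [/\ symmetric F, subrel F e, forall x y, connect F x y, ecount F + 2 = 2 * #|T| &
      forall x y, e x y -> ~~ F x y -> deg F x = deg F y].

Lemma connected_deg_gt0 (T : finType) (F : rel T) x y :
  x != y -> connect F x y -> 0 < deg F x.
Proof.
move=> xy /connectP[[|z p] /= pth lst]; first by rewrite lst eqxx in xy.
by apply/card_gt0P; exists z; rewrite inE; case/andP: pth.
Qed.

Section Decomposition.
Variables (T : finType) (e : rel T).
Hypotheses (sime : simple_graph e) (cube : cubic e).

Lemma cubic_card_gt0 (x : T) : 3 < #|T|.
Proof.
have := cube x; rewrite /deg => <-; rewrite -[#|T|]cardsT.
apply: proper_card; rewrite properT; apply/negP => /eqP/setP/(_ x).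
by rewrite !inE (proj2 sime).
Qed.

Lemma cubic_split (F : rel T) x : subrel F e ->
  deg F x + \sum_w (e x w && ~~ F x w) = 3.
Proof.
move=> sF; rewrite -(cube x) !degE -big_split; apply: eq_bigr => w _ /=.
by have := @sF x w; case: (F x w) => // [/(_ isT) -> | _]; rewrite ?andbT.
Qed.

Lemma three_decompositionP : 0 < #|T| ->
  three_decomposition e <-> exists F, balanced_tree e F.
Proof.
case/card_gt0P=> x0 _; have T4 := cubic_card_gt0 x0; have T0 : 0 < #|T| by lia.
case: sime => syme irre.
have neq x : exists y : T, x != y.
  have : 0 < #|[set~ x]| by rewrite cardsC1; lia.
  by case/card_gt0P => y; rewrite !inE eq_sym => ?; exists y.
split=> [[F1 [F2 [F3 [[s1 s2 s3] [sub [part [sp reg mat]]]]]]] | [F [sF subF cF nF lF]]].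
- have sub1 : subrel F1 e by move=> x y H; apply: sub; rewrite H.
  have irr1 : irreflexive F1.
    by move=> x; apply/negP => /sub1; rewrite irre.
  have [cF nF] := (spanning_treeP s1 irr1 T0).1 sp.
  exists F1; split=> // x y exy nF1.
  have d1 z : 0 < deg F1 z by have [t zt] := neq z; apply: connected_deg_gt0 zt _.
  have tot z : deg F1 z + deg F2 z + deg F3 z = 3.
    rewrite -(cube z) !degE -!big_split; apply: eq_bigr => w _ /=.
    have := sub z w; have := part z w.
    case: (e z w) => [/(_ isT) H _|_ H]; first by case: H => /and3P[]; case: (F1 z w); case: (F2 z w); case: (F3 z w).
    by move: H; case: (F1 z w); case: (F2 z w); case: (F3 z w) => //= /(_ isT).
  have pos (Q : rel T) z w : Q z w -> 0 < deg Q z.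
    by move=> H; apply/card_gt0P; exists w; rewrite inE.
  (* The degrees in the three classes sum to 3, the first being positive, the second 0 or 2 and the
     third at most 1; so the class of a non-tree edge fixes the tree degree of its ends. *)
  have key (a b : T) : F2 a b || F3 a b -> deg F1 a = if F2 a b then 1 else 2.
    have := tot a; have := d1 a; have := reg a; have := mat a.
    case H2 : (F2 a b) => /=; first by have := pos _ _ _ H2; case: (reg a); lia.
    by move=> m r ? ? H3; have := pos _ _ _ H3; case: r; lia.
  have H : F2 x y || F3 x y by case: (part x y exy) => /and3P[a b c]; rewrite ?b ?c ?orbT // (negbTE nF1) in a *.
  by rewrite (key x y H) (key y x) ?[F2 y x]s2 ?[F3 y x]s3.
- have irrF : irreflexive F by move=> x; apply/negP => /subF; rewrite irre.
  have d1 z : 0 < deg F z by have [t zt] := neq z; apply: connected_deg_gt0 zt _.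
  (* Balance is exactly what makes these two relations symmetric. *)
  exists F, (fun x y => [&& e x y, ~~ F x y & deg F x == 1]),
    (fun x y => [&& e x y, ~~ F x y & deg F x != 1]); split; first split=> //.
  + by move=> x y /=; rewrite [e y x]syme [F y x]sF; case exy: (e x y) => //=; case Fxy: (F x y) => //=; rewrite (lF x y) ?Fxy.
  + by move=> x y /=; rewrite [e y x]syme [F y x]sF; case exy: (e x y) => //=; case Fxy: (F x y) => //=; rewrite (lF x y) ?Fxy.
  split; first by move=> x y; case Fxy: (F x y) => /=; [rewrite (subF _ _ Fxy)|case: (e x y)].
  split.
    move=> x y ->; case: (F x y) => /=; first exact: Or31.
    by case: eqP => _ /=; [apply: Or32|apply: Or33].
  split.
  + exact/(spanning_treeP sF irrF T0).
  + move=> v; rewrite degE; have := cubic_split v subF.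
    case: (deg F v =P 1) => [->|_] /= H; last by left; rewrite big1 // => w _; rewrite !andbF.
    by right; rewrite -[RHS]/(3 - 1) -H addKn; apply: eq_bigr => w _; rewrite andbT.
  + move=> v; rewrite degE; have := cubic_split v subF; have := d1 v.
    case: (deg F v =P 1) => [_|n1] /= d0 H; first by rewrite big1 // => w _; rewrite !andbF.
     have -> : \sum_w (e v w && (~~ F v w && true) : nat) = \sum_w (e v w && ~~ F v w : nat).
      by apply: eq_bigr => w _; rewrite andbT.
    by lia.
Qed.

End Decomposition.

(** * Edge cuts *)

Definition cut (T : finType) (e : rel T) (A : pred T) : nat :=
  \sum_x \sum_y [&& A x, ~~ A y & e x y].

Definition cut3 (T : finType) (e : rel T) : Prop :=
  forall A : pred T, (exists x, A x) -> (exists y, ~~ A y) -> 3 <= cut e A.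

Lemma cut_card (T : finType) (e : rel T) (A : pred T) :
  cut e A = #|[set p : T * T | [&& A p.1, ~~ A p.2 & e p.1 p.2]]|.
Proof.
rewrite /cut pair_big -sum1_card [RHS]big_mkcond /=.
by apply: eq_bigr => p _; rewrite inE; case: ifP.
Qed.

Lemma connect_cross (T : finType) (F : rel T) (A : pred T) x y :
  connect F x y -> A x -> ~~ A y -> exists u v, [/\ connect F x u, F u v, A u & ~~ A v].
Proof.
case/connectP=> p; elim/last_ind: p y => [|p z IH] y /=; first by move=> _ -> ->.
rewrite rcons_path last_rcons => /andP[pth Fz] -> Ax Az.
case Al : (A (last x p)); last by apply: (IH _ pth erefl Ax); rewrite Al.
by exists (last x p), z; split=> //; apply/connectP; exists p.
Qed.

Lemma cutC (T : finType) (e : rel T) (A : pred T) : symmetric e ->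
  cut e (predC A) = cut e A.
Proof.
move=> syme; rewrite /cut exchange_big; do 2!(apply: eq_bigr => ? _).
by rewrite /= negbK syme andbCA.
Qed.

Section Connectivity.
Variables (T : finType) (e : rel T).
Hypotheses (sime : simple_graph e) (cube : cubic e).

(** A cut of at most two edges yields a vertex separator by deleting an end of each, on different
    sides if there are two edges. It separates unless a side consists of the deleted vertex alone,
    and the cut around a single vertex has three edges. *)
Lemma k_connected_cut3 : k_connected 3 e -> cut3 e.
Proof.
move=> [_ conn] A [x Ax] [y Ay].
have single (B : pred T) a : B a -> (forall b, B b -> b = a) -> 3 <= cut e B.
  move=> Ba Bs; rewrite /cut (bigD1 a) //= -(cube a) degE.
  apply: leq_trans (leq_addr _ _); apply: leq_sum => b _; rewrite Ba /=.
  case eab: (e a b) => //; rewrite andbT; case Bb: (B b) => //.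
  by rewrite (Bs _ Bb) (proj2 sime) in eab.
have crossP (S : {set T}) x' y' : #|S| < 3 -> A x' -> x' \notin S -> ~~ A y' -> y' \notin S ->
  exists u v, [/\ A u, ~~ A v, e u v, u \notin S & v \notin S].
  move=> S3 Ax' x'S Ay' y'S.
  have := conn S S3 x' y'; rewrite !inE => /(_ x'S y'S) H.
  have [u [v [_]]] := connect_cross H Ax' Ay'.
  rewrite /induced_rel /= => /and3P[euv]; rewrite !inE => uS vS Au Av.
  by exists u, v.
rewrite leqNgt; apply/negP => small.
move: (small); rewrite cut_card cardE.
set D := [set p | _]; case Ds : (enum D) => [|p [|q [|? ?]]] // _.
  have [|||||u [v [Au Av euv _ _]]] := @crossP set0 x y; rewrite ?inE ?cards0 //.
  have : (u, v) \in enum D by rewrite mem_enum inE /= Au Av.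
  by rewrite Ds.
all: have /[!(mem_enum, inE)] /and3P[Ap1 Ap2 ep] : p \in enum D by rewrite Ds inE eqxx.
- have [/existsP[x' /andP[Ax' x'p]]|/existsPn H] := boolP [exists x', A x' && (x' != p.1)]; last first.
    suff : 3 <= cut e A by lia.
    by apply: (single _ p.1) => // b Ab; have := H b; rewrite Ab => /negPn/eqP.
  have [|||||u [v [Au Av euv uS vS]]] := @crossP [set p.1] x' y; rewrite ?inE ?cards1 //.
    by apply: contraNneq Ay => ->.
  have : (u, v) \in enum D by rewrite mem_enum inE /= Au Av.
  by rewrite Ds !inE => /eqP E; rewrite inE -E eqxx in uS.
- have /[!(mem_enum, inE)] /and3P[Aq1 Aq2 eq] : q \in enum D by rewrite Ds !inE eqxx orbT.
  have [/existsP[x' /andP[Ax' x'p]]|/existsPn H] := boolP [exists x', A x' && (x' != p.1)]; last first.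
    suff : 3 <= cut e A by lia.
    by apply: (single _ p.1) => // b Ab; have := H b; rewrite Ab => /negPn/eqP.
  have [/existsP[y' /andP[Ay' y'q]]|/existsPn H] := boolP [exists y', ~~ A y' && (y' != q.2)]; last first.
    suff : 3 <= cut e (predC A) by rewrite (cutC A (proj1 sime)) leqNgt small.
    by apply: (single _ q.2) => // b /= Ab; have := H b; rewrite Ab => /negPn/eqP.
  have [|||||u [v [Au Av euv uS vS]]] := @crossP [set p.1; q.2] x' y'; rewrite ?inE ?negb_or //.
  + by rewrite cardsU1 cards1; case: (_ \notin _).
  + by rewrite x'p; apply: contraNneq Aq2 => <-.
  + by rewrite y'q andbT; apply: contraNneq Ay' => ->.
  have : (u, v) \in enum D by rewrite mem_enum inE /= Au Av.
  move: uS vS; rewrite Ds !inE !negb_or => /andP[up _] /andP[_ vq] /orP[] /eqP E.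
    by rewrite -E eqxx in up.
  by rewrite -E eqxx in vq.
Qed.

(** A single separating vertex cannot send three edges to both sides. For a separator [s], [t], the
    cuts around [A] and [B] use up all six edge ends, so [s] and [t] are not adjacent,
    [N A t = N B s] and [N A s = N B t]. Adding [s] or [t] to [A] then requires [N A s] and [N B s]
    both to be at least 2, which exceeds degree 3. *)
Lemma cut3_k_connected : 0 < #|T| -> cut3 e -> k_connected 3 e.
Proof.
case: sime => syme irre.
move=> T0 c3; split; first by case/card_gt0P: T0 => x _; have := cubic_card_gt0 sime cube x; lia.
move=> S S3 x y; rewrite !inE => xS yS; apply: contraTT isT => nxy.
pose A : pred T := connect (induced_rel e (~: S)) x.
pose B : pred T := fun z => (z \notin S) && ~~ A z.
have AS z : A z -> z \notin S.
  case/connectP=> p; case/lastP: p => [|p w] /=; first by move=> _ ->.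
  by rewrite rcons_path last_rcons /= => /andP[_ /and3P[_ _]] wS ->; rewrite inE in wS.
have AB u v : A u -> B v -> e u v = false.
  move=> Au /andP[vS nAv]; apply/negP => euv; case/negP: nAv.
  by apply: (connect_trans Au); apply: connect1; rewrite /induced_rel /= euv !inE vS (AS _ Au).
pose N (P : pred T) u : nat := \sum_z (P z && e u z).
have cutS (P : pred T) : (forall u, P u -> u \notin S) -> (forall u v, P u -> ~~ P v -> v \notin S -> e u v = false) ->
    cut e P = \sum_(w <- enum S) N P w.
  move=> PS Pe; rewrite /cut exchange_big big_enum [RHS]big_mkcond; apply: eq_bigr => w _ /=.
  case wS : (w \in S).
    have -> /= : ~~ P w by apply/negP => /PS; rewrite wS.
    by apply: eq_bigr => z _; rewrite syme.
  by rewrite big1 // => z _; case Pz : (P z) => //=; case Pw : (P w) => //=; rewrite Pe ?Pw ?wS.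
have N1 u z : N (pred1 z) u = e u z.
  by rewrite /N (bigD1 z) //= eqxx big1 ?addn0 // => w /negbTE ->.
have degN u (P : pred T) : (forall z, ~~ (A z && P z)) -> (forall z, ~~ (B z && P z)) -> N A u + N B u + N P u <= 3.
  move=> AP BP; rewrite -(cube u) degE -!big_split; apply: leq_sum => z _ /=.
  by have := AP z; have := BP z; rewrite /B; case: (e u z); case: (A z); case: (z \in S); case: (P z).
have NE P u : N P u = \sum_z (P z && e u z) by [].
clearbody N.
have Ax : A x by exact: connect0.
have By : B y by rewrite /B yS.
have nBx : ~~ B x by rewrite /B Ax andbF.
have := c3 A (ex_intro _ x Ax) (ex_intro _ y nxy).
have := c3 B (ex_intro _ y By) (ex_intro _ x nBx).
rewrite !cutS //; last first.
- by move=> u v Bu; rewrite /B => nBv vS; rewrite syme AB //; move: nBv; rewrite vS negbK.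
- by move=> u /andP[].
- by move=> u v Au nAv vS; apply: AB => //; rewrite /B vS.
have := S3; rewrite cardE; case ES: (enum S) => [|s [|t [|? ?]]] //= _.
- by rewrite big_nil.
- rewrite !big_seq1; have := degN s pred0; rewrite /= => H.
  by have {}H : N A s + N B s + N pred0 s <= 3; [apply: H => z; rewrite andbF | lia].
have [sS tS] : s \in S /\ t \in S by rewrite -!(mem_enum S) ES !inE !eqxx orbT.
have notS u z : u \in S -> (~~ (A z && pred1 u z)) && ~~ (B z && pred1 u z).
  move=> uS; case: (z =P u) => [->|/eqP/negbTE zu] /=; last by rewrite zu !andbF.
  by rewrite /B eqxx uS !andbT /=; apply/negP=> /AS; rewrite uS.
have Ds := degN s (pred1 t) (fun z => proj1 (andP (notS t z tS))) (fun z => proj2 (andP (notS t z tS))).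
have Dt := degN t (pred1 s) (fun z => proj1 (andP (notS s z sS))) (fun z => proj2 (andP (notS s z sS))).
have grow a b : a \in S -> b \in S -> S =i [:: a; b] -> 3 <= N A b + N B a + e a b.
  move=> aS bS Sab; pose A' : pred T := fun z => (z == a) || A z.
  have /leq_trans -> // : 3 <= cut e A'.
    apply: c3; [by exists x; rewrite /A' Ax orbT | exists y].
    by rewrite /A' negb_or nxy andbT; apply: contraNneq yS => ->.
  (* An edge that leaves [A'] runs from [A] to [b], from [a] to [B], or from [a] to [b]; the
     products count these three kinds. *)
  apply: (@leq_trans (\sum_z \sum_w ((w == b) * (A z && e b z) +
                       (z == a) * ((B w && e a w) + (w == b) * e a b)))).
    apply: leq_sum => z _; apply: leq_sum => w _; rewrite /A'.
    case ezw: (e z w); last by rewrite !andbF.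
    have [//|wa] /= := eqVneq w a; first by rewrite andbF.
    case Aw: (A w); first by rewrite !andbF.
    have wB : (w == b) || B w.
      rewrite /B Aw andbT; case wS : (w \in S); last by rewrite orbT.
      by move: wS; rewrite Sab !inE (negbTE wa) /= => ->.
    case: (z =P a) ezw => [-> | _] ezw /=.
      by move: wB ezw; case: (w =P b) => [->|_] /=; [move=> _ ->; rewrite !mul1n !addn1 addnS | move=> -> ->; rewrite mul1n].
    case Az : (A z) => //=; case: (w =P b) wB ezw => [->|_] /=; first by rewrite syme => _ ->.
    by move=> Bw; rewrite AB.
  rewrite (eq_bigr (fun z => (A z && e b z) + (z == a) * (N B a + e a b))).
    rewrite big_split /= -(NE A b); have -> : \sum_z (z == a) * (N B a + e a b) = N B a + e a b.
      by rewrite (bigD1 a) //= eqxx big1 ?addn0 ?mul1n // => z /negbTE ->.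
    by rewrite addnA.
  move=> z _; rewrite big_split /= -big_distrr /= big_split /= -(NE B a); congr (_ + _ * (_ + _)).
    by rewrite (bigD1 b) //= eqxx big1 ?addn0 ?mul1n // => w /negbTE ->.
  by rewrite (bigD1 b) //= eqxx big1 ?addn0 ?mul1n // => w /negbTE ->.
have g1 := grow s t sS tS; have g2 := grow t s tS sS.
have {}g1 : 3 <= N A t + N B s + e s t by apply: g1 => z; rewrite -(mem_enum S) ES.
have {}g2 : 3 <= N A s + N B t + e t s.
  by apply: g2 => z; rewrite -(mem_enum S) ES !inE orbC.
rewrite !big_cons !big_nil; move: Ds Dt g1 g2; rewrite !N1 [e t s]syme; clear; lia.
Qed.
End Connectivity.

(** * Gluing a piece to an outer graph *)

(** [top] is the number of vertices less one, so the vertex type is never empty and [inord] is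
    available. A leg stands for an edge leaving the piece and records only its inner end; outer ends
    come from a separate map [lo], so that two pieces can be glued to the same outer graph. *)
Record piece := Piece { top : nat; edges : seq (nat * nat); legs : seq nat }.

Notation nverts P := (top P).+1.
Notation leg P i := (nth 0 (legs P) i).
Notation arity P := (size (legs P)).

Definition flip (p : nat * nat) : nat * nat := (p.2, p.1).

(** Uniqueness together with the flipped pairs excludes loops and edges listed in both directions,
    so sums over the relation become sums over the list. *)
Definition wf_edges (n : nat) (E : seq (nat * nat)) : bool :=
  all (fun p => (p.1 < n) && (p.2 < n)) E && uniq (E ++ map flip E).

Definition wf_piece (P : piece) : bool :=
  wf_edges (nverts P) (edges P) && all (fun a => a < nverts P) (legs P).

Definition ldeg (P : piece) (S : seq (nat * nat)) (L : seq nat) (a : nat) : nat :=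
  count (fun p => p.1 == a) S + count (fun p => p.2 == a) S
    + count (fun i => leg P i == a) L.

Lemma sum_count (I : Type) (p : pred I) (s : seq I) : \sum_(i <- s) p i = count p s.
Proof. by elim: s => [|i s IH] /=; rewrite ?big_nil // big_cons IH. Qed.

Lemma sum_ord_eq n a (f : nat -> nat) : a < n -> \sum_(b < n) (a == b) * f b = f a.
Proof.
move=> an; rewrite (bigD1 (Ordinal an)) //= eqxx mul1n big1 ?addn0 // => b nb.
by rewrite eq_sym -val_eqE /= in nb; rewrite (negbTE nb).
Qed.

Lemma sum_eq (T : finType) a (f : T -> nat) : \sum_b (a == b) * f b = f a.
Proof.
rewrite (bigD1 a) //= eqxx mul1n big1 ?addn0 // => b nb.
by rewrite eq_sym (negbTE nb).
Qed.

Lemma has_sum (I : eqType) (p : pred I) (s : seq I) :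
  uniq s -> (forall i j, i \in s -> j \in s -> p i -> p j -> i = j) ->
  has p s = \sum_(i <- s) p i :> nat.
Proof.
elim: s => [|i s IH] /=; first by rewrite big_nil.
case/andP=> nis us H; rewrite big_cons -IH //; last first.
  by move=> a b sa sb; apply: H; rewrite inE ?sa ?sb orbT.
case pi: (p i) => //=; case: hasP => // -[j sj pj].
by rewrite (H i j) ?inE ?eqxx ?sj ?orbT // in nis; rewrite sj in nis.
Qed.

Lemma sum_graph_of n (E : seq (nat * nat)) (w : nat -> nat -> nat) : wf_edges n E ->
  \sum_a \sum_b @graph_of n E a b * w a b = \sum_(p <- E) (w p.1 p.2 + w p.2 p.1).
Proof.
move=> /andP[/allP bnd]; rewrite cat_uniq => /and3P[uE /hasPn disj _].
have eqE (a b : nat) : ((a, b) \in E) = count (fun p => (p.1 == a) && (p.2 == b)) E :> nat.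
  by rewrite -(count_uniq_mem _ uE); apply: eq_count => -[x y]; rewrite /= xpair_eqE.
have -> : \sum_a \sum_b @graph_of n E a b * w a b =
    \sum_(a < n) \sum_(b < n) \sum_(p <- E) ((p.1 == a) * ((p.2 == b) * w a b) + (p.2 == a) * ((p.1 == b) * w a b)).
  apply: eq_bigr => a _; apply: eq_bigr => b _; rewrite /graph_of.
  have -> : ((a : nat, b : nat) \in E) || ((b : nat, a : nat) \in E) =
            ((a : nat, b : nat) \in E) + ((b : nat, a : nat) \in E) :> nat.
    case H1: (_ \in E); case H2: (_ \in E) => //.
    by have := disj (a : nat, b : nat); rewrite -[(_, _)]/(flip (b : nat, a : nat)) map_f // H1 => /(_ isT).
  rewrite big_split /= mulnDl !eqE -!sum_count !big_distrl.
  by congr (_ + _); apply: eq_bigr => p _; rewrite /= mulnA mulnb // andbC.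
rewrite (eq_bigr _ (fun a _ => exchange_big _ _ _ _ _ _)) exchange_big.
apply: eq_big_seq => p /bnd/andP[p1 p2] /=.
rewrite (eq_bigr _ (fun a _ => big_split _ _ _ _ _)) big_split /=.
congr (_ + _); under eq_bigr => a _ do rewrite -big_distrr /= sum_ord_eq //.
  by rewrite (@sum_ord_eq n _ (fun a => w a p.2)).
by rewrite (@sum_ord_eq n _ (fun a => w a p.1)).
Qed.

Lemma deg_graph_of n (E : seq (nat * nat)) (a : 'I_n) : wf_edges n E ->
  deg (@graph_of n E) a = count (fun p => p.1 == a :> nat) E + count (fun p => p.2 == a :> nat) E.
Proof.
move=> wfE; have H := sum_graph_of (fun x _ => x == a) wfE.
rewrite big_split /= !sum_count in H; rewrite -H degE [RHS](bigD1 a) //= [X in _ + X]big1 ?addn0.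
  by apply: eq_bigr => b _; rewrite eqxx muln1.
by move=> b nb; rewrite big1 // => c _; rewrite -val_eqE /= in nb; rewrite (negbTE nb) muln0.
Qed.

Lemma ecount_graph_of n (E : seq (nat * nat)) : wf_edges n E ->
  ecount (@graph_of n E) = 2 * size E.
Proof.
move=> wfE; have := sum_graph_of (fun _ _ => 1) wfE.
rewrite big_split /= !sum1_size addnn -mul2n => <-.
by apply: eq_bigr => r _; apply: eq_bigr => a _; rewrite muln1.
Qed.

Lemma graph_of_sym n (E : seq (nat * nat)) : symmetric (@graph_of n E).
Proof. by move=> a b; rewrite /graph_of orbC. Qed.

Section Glue.
Variables (R : finType) (lo : nat -> R) (P : piece).

(** [E] and [L] may be sublists of the edges and legs of [P], so one construction serves a graph and
    its subgraphs; by [glue_sub] every symmetric subgraph arises in this way. *)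
Definition glue (eR : rel R) (E : seq (nat * nat)) (L : seq nat) : rel (R + 'I_(nverts P)) :=
  fun u v =>
  match u, v with
  | inl r, inl s => eR r s
  | inr a, inr b => graph_of E a b
  | inl r, inr a | inr a, inl r => has (fun i => (lo i == r) && (leg P i == a)) L
  end.

(** Two legs at the same vertex of the piece with a common outer end would collapse to one edge of
    the glued graph and spoil all degree counts. *)
Definition simple_legs (L : seq nat) : Prop :=
  uniq L /\ {in L &, forall i j, lo i = lo j -> leg P i = leg P j -> i = j}.

Lemma sum_legs (L : seq nat) (w : R -> nat -> nat) :
  all (fun a => a < nverts P) (legs P) -> simple_legs L ->
  \sum_r \sum_(a < nverts P) (has (fun i => (lo i == r) && (leg P i == a)) L) * w r a
    = \sum_(i <- L) w (lo i) (leg P i).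
Proof.
move=> bnd [uL inj].
have lt i : leg P i < nverts P.
  by case: (ltnP i (arity P)) => H; [apply/(allP bnd)/mem_nth | rewrite nth_default].
under eq_bigr => r _ do under eq_bigr => a _ do
  (rewrite has_sum //; last by (move=> i j Li Lj /andP[/eqP <- /eqP Ja] /andP[/eqP lij /eqP Jb]; apply: inj => //; rewrite Ja)).
have -> : \sum_r \sum_(a < nverts P) (\sum_(i <- L) (lo i == r) && (leg P i == a)) * w r a =
   \sum_r \sum_(a < nverts P) \sum_(i <- L) (lo i == r) * ((leg P i == a) * w r a).
  by apply: eq_bigr => r _; apply: eq_bigr => a _; rewrite big_distrl; apply: eq_bigr => i _; rewrite /= mulnA mulnb.
rewrite (eq_bigr _ (fun a _ => exchange_big _ _ _ _ _ _)) exchange_big; apply: eq_bigr => i _ /=.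
under eq_bigr => r _ do rewrite -big_distrr /= sum_ord_eq //.
exact: sum_eq.
Qed.

Section Facts.
Variables (eR : rel R) (E : seq (nat * nat)) (L : seq nat).
Hypotheses (bnd : all (fun a => a < nverts P) (legs P)) (wfE : wf_edges (nverts P) E)
  (sL : simple_legs L).

Lemma deg_glue_inr a : deg (glue eR E L) (inr a) = ldeg P E L a.
Proof.
rewrite degE big_sumType /= addnC /ldeg; congr (_ + _).
  by rewrite -deg_graph_of // degE.
have := sum_legs (fun _ b => b == a) bnd sL; rewrite sum_count => <-.
apply: eq_bigr => r _; rewrite (bigD1 a) //= eqxx muln1 big1 ?addn0 // => b nb.
by rewrite -val_eqE /= in nb; rewrite (negbTE nb) muln0.
Qed.

Lemma deg_glue_inl r :
  deg (glue eR E L) (inl r) = deg eR r + count (fun i => lo i == r) L.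
Proof.
rewrite !degE big_sumType /=; congr (_ + _).
have := sum_legs (fun s _ => s == r) bnd sL; rewrite sum_count => <-.
rewrite exchange_big; apply: eq_bigr => a _; rewrite (bigD1 r) //= eqxx muln1 big1 ?addn0 //.
by move=> s /negbTE ns; rewrite ns muln0.
Qed.

Lemma ecount_glue : ecount (glue eR E L) = ecount eR + 2 * (size E + size L).
Proof.
rewrite /ecount big_sumType /=.
under eq_bigr => r _ do rewrite big_sumType /=.
under [X in _ + X]eq_bigr => r _ do rewrite big_sumType /=.
rewrite !big_split /= [X in _ + (X + _)]exchange_big /=.
have -> : \sum_r \sum_(a < nverts P) has (fun i => (lo i == r) && (leg P i == a)) L = size L.
  have := sum_legs (fun _ _ => 1) bnd sL; rewrite sum1_size => <-.
  by apply: eq_bigr => r _; apply: eq_bigr => a _; rewrite muln1.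
have := ecount_graph_of wfE; rewrite /ecount => ->.
lia.
Qed.

Lemma cut_glue (A : pred (R + 'I_(nverts P))) (b : nat -> bool) :
  (forall a, A (inr a) = b a) ->
  cut (glue eR E L) A = cut eR (fun r => A (inl r))
     + count (fun p => b p.1 != b p.2) E + count (fun i => A (inl (lo i)) != b (leg P i)) L.
Proof.
move=> Ab; rewrite /cut big_sumType /=.
under eq_bigr => r _ do rewrite big_sumType /=.
under [X in _ + X]eq_bigr => r _ do rewrite big_sumType /=.
rewrite !big_split /= [X in _ + (X + _)]exchange_big /=.
rewrite [X in _ + X = _]addnC addnACA; congr (_ + _ + _).
  have := sum_graph_of (fun x y => b x && ~~ b y) wfE.
  rewrite (eq_bigr (fun p => (b p.1 != b p.2 : nat))) ?sum_count; last first.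
    by move=> p _; case: (b _); case: (b _).
  move=> <-; apply: eq_bigr => x _; apply: eq_bigr => y _.
  by rewrite !Ab mulnb [in RHS]andbC -andbA.
rewrite -big_split /=.
have := sum_legs (fun r y => A (inl r) != b y) bnd sL; rewrite sum_count => <-.
apply: eq_bigr => r _; rewrite -big_split /=; apply: eq_bigr => y _.
by rewrite !Ab; case: (A _); case: (b _); case: (has _ _).
Qed.

Lemma glue_sym : symmetric eR -> symmetric (glue eR E L).
Proof. by move=> sR [r|a] [s|b] //=; rewrite /graph_of orbC. Qed.

Lemma glue_irr : irreflexive eR -> irreflexive (glue eR E L).
Proof.
move=> iR [r|a] //=; rewrite /graph_of orbb; apply/negP => H.
case/andP: wfE => _; rewrite cat_uniq => /and3P[_ /hasPn/(_ (a : nat, a : nat))].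
by rewrite -[X in X \in map _ _]/(flip (a : nat, a : nat)) map_f // H => /(_ isT).
Qed.

End Facts.

Lemma glue_sub (eR : rel R) (E : seq (nat * nat)) (L : seq nat) (F : rel (R + 'I_(nverts P))) :
  symmetric F -> subrel F (glue eR E L) ->
  F =2 glue (fun r s => F (inl r) (inl s))
         [seq p <- E | F (inr (inord p.1)) (inr (inord p.2))]
         [seq i <- L | F (inl (lo i)) (inr (inord (leg P i)))].
Proof.
move=> sF subF.
have leg_case r (a : 'I_(nverts P)) : F (inl r) (inr a) = has (fun i => (lo i == r) && (leg P i == a))
    [seq i <- L | F (inl (lo i)) (inr (inord (leg P i)))].
  apply/idP/hasP => [H|[i]].
    have /= /hasP[i Li /andP[/eqP lr /eqP la]] := subF _ _ H.
    by exists i; rewrite ?lr ?la ?eqxx // mem_filter lr la inord_val H.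
  by rewrite mem_filter => /andP[H _] /andP[/eqP lr /eqP la]; rewrite lr la inord_val in H.
move=> [r|a] [s|b]; rewrite ?(sF (inr a) (inl s)) //=.
rewrite /graph_of !mem_filter /= !inord_val [F (inr b) (inr a)]sF -andb_orr.
by have := subF (inr a) (inr b); rewrite /= /graph_of; case: (F _ _) => // /(_ isT) ->.
Qed.

End Glue.
Arguments glue {R} lo P eR E L _ _ /.
Arguments simple_legs {R} lo P L.

(** * Extending trees across a replacement *)

Definition merge_labels (lab : seq nat) (p : nat * nat) : seq nat :=
  let a := nth 0 lab p.1 in let b := nth 0 lab p.2 in
  [seq if c == a then b else c | c <- lab].

(** Connected components by repeated relabelling, in a form suited to [vm_compute]: each edge merges
    the label classes of its two ends. *)
Definition labels (N : nat) (es : seq (nat * nat)) : seq nat :=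
  foldl merge_labels (iota 0 N) es.

Definition bounded (N : nat) (es : seq (nat * nat)) : bool :=
  all (fun p => (p.1 < N) && (p.2 < N)) es.

Lemma size_merge_labels lab p : size (merge_labels lab p) = size lab.
Proof. exact: size_map. Qed.

Lemma nth_merge_labels lab p x : x < size lab ->
  nth 0 (merge_labels lab p) x =
    if nth 0 lab x == nth 0 lab p.1 then nth 0 lab p.2 else nth 0 lab x.
Proof. by move=> H; rewrite (nth_map 0). Qed.

(** [E] is any equivalence relation containing the edges, so that equal labels in a small piece can
    be read as connectedness in a large glued graph. *)
Lemma labels_sound N es (E : nat -> nat -> Prop) :
  (forall x, E x x) -> (forall x y, E x y -> E y x) ->
  (forall x y z, E x y -> E y z -> E x z) ->
  bounded N es -> (forall p, p \in es -> E p.1 p.2) ->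
  forall x y, x < N -> y < N -> nth 0 (labels N es) x = nth 0 (labels N es) y -> E x y.
Proof.
move=> refl sym trans bnd sub x y; rewrite /labels.
have : forall x y, x < N -> y < N -> nth 0 (iota 0 N) x = nth 0 (iota 0 N) y -> E x y.
  by move=> {}x {}y xN yN; rewrite !nth_iota // !add0n => ->.
have : size (iota 0 N) = N by rewrite size_iota.
move: (iota 0 N) x y; elim: es bnd sub => [|p es IH] bnd sub lab x y szN old xN yN //=; first exact: old.
move: bnd => /= /andP[/andP[p1 p2] bnd].
apply: IH => //; [by move=> q qe; apply: sub; rewrite inE qe orbT | by rewrite size_merge_labels |].
have Ep : E p.1 p.2 by apply: sub; rewrite inE eqxx.
move=> u v uN vN; rewrite !nth_merge_labels ?szN //; case: eqP => Hu; case: eqP => Hv.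
- by move=> _; apply: old; rewrite // Hu.
- by move=> H; exact: trans (trans _ _ _ (old _ _ uN p1 Hu) Ep) (old _ _ p2 vN H).
- by move=> H; exact: sym (trans _ _ _ (trans _ _ _ (old _ _ vN p1 Hv) Ep) (old _ _ p2 uN (esym H))).
- exact: old.
Qed.

Lemma labels_complete N es p : bounded N es -> p \in es ->
  nth 0 (labels N es) p.1 = nth 0 (labels N es) p.2.
Proof.
move=> bnd pe; have /andP[p1 p2] := allP bnd _ pe; rewrite /labels.
have keep x y (xN : x < N) (yN : y < N) l lab : size lab = N ->
    nth 0 lab x = nth 0 lab y ->
    nth 0 (foldl merge_labels lab l) x = nth 0 (foldl merge_labels lab l) y.
  elim: l lab => [|q l IH] lab szN H //=; apply: IH; first by rewrite size_merge_labels.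
  by rewrite !nth_merge_labels ?szN // H.
have : size (iota 0 N) = N by rewrite size_iota.
move: (iota 0 N); elim: es pe {bnd} => [|q es IH] //=.
rewrite inE => /orP[/eqP <-|pe] lab szN; last by apply: IH; rewrite ?size_merge_labels.
apply: keep => //; first by rewrite size_merge_labels.
by rewrite !nth_merge_labels ?szN // eqxx; case: eqP.
Qed.

(** * The finite lifting test *)

Fixpoint subseqs (T : Type) (s : seq T) : seq (seq T) :=
  if s is x :: s' then let r := subseqs s' in r ++ map (cons x) r else [:: [::]].

Lemma filter_subseqs (T : eqType) (a : pred T) s : filter a s \in subseqs s.
Proof.
elim: s => [|x s IH] //=; rewrite mem_cat; case: (a x); last by rewrite IH.
by rewrite map_f ?orbT.
Qed.

Lemma subseqsP (T : eqType) (s t : seq T) : t \in subseqs s -> subseq t s.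
Proof.
elim: s t => [|x s IH] t /=; first by rewrite inE => /eqP ->.
rewrite mem_cat => /orP[/IH H|/mapP[u /IH H ->]]; last by rewrite /= eqxx.
exact: subseq_trans H (subseq_cons _ _).
Qed.

(** Node [nverts P + i] represents the outer end of leg [i], and [ex] lists pairs of outer ends
    known to be connected outside. Legs with a common outer end still get different nodes: apart
    from [ex], no connection made outside the piece is recorded. *)
Definition wires (P : piece) (S : seq (nat * nat)) (L : seq nat) (ex : seq (nat * nat)) :=
  S ++ [seq (leg P i, nverts P + i) | i <- L]
    ++ [seq (nverts P + p.1, nverts P + p.2) | p <- ex].

Definition wire_labels (P : piece) S L ex : seq nat :=
  labels (nverts P + arity P) (wires P S L ex).

Definition balanced_edges (P : piece) S L : bool :=
  all (fun p => (p \in S) || (ldeg P S L p.1 == ldeg P S L p.2)) (edges P).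

(** These are necessary conditions on the part of a balanced tree inside the piece: in particular
    every inner vertex must reach the outside by a tree leg. States that no tree realises may pass;
    they merely enlarge the check. *)
Definition valid (P : piece) S L : bool :=
  balanced_edges P S L &&
  (let lab := wire_labels P S L [::] in
   all (fun y => has (fun i => nth 0 lab y == nth 0 lab (nverts P + i)) L) (iota 0 (nverts P))).

(** A tree path between outer vertices alternates between stretches outside and passages through
    [Y]. The first condition replaces each passage by a connection through [X]; the second attaches
    the inner vertices of [X]. *)
Definition refines (X Y : piece) (labX labY : seq nat) : bool :=
  all (fun i => all (fun j => (nth 0 labY (nverts Y + i) == nth 0 labY (nverts Y + j)) ==>
                              (nth 0 labX (nverts X + i) == nth 0 labX (nverts X + j)))
         (iota 0 (arity X))) (iota 0 (arity X))
  && all (fun a => has (fun i => nth 0 labX a == nth 0 labX (nverts X + i)) (iota 0 (arity X)))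
       (iota 0 (nverts X)).

(* The conditionals, unlike [&&], keep [vm_compute] from evaluating the later tests. *)
Definition extends (X Y : piece) ex SY LY SX U : bool :=
  let LX := LY ++ U in
  if size SX + size LX + nverts Y == size SY + size LY + nverts X then
  if balanced_edges X SX LX then
  if all (fun i => (i \in LX) || (ldeg X SX LX (leg X i) == ldeg Y SY LY (leg Y i)))
       (iota 0 (arity X)) then
    refines X Y (wire_labels X SX LX ex) (wire_labels Y SY LY [::])
  else false else false else false.

(** By balance, the outer end of a non-tree leg has the same tree degree as the inner end; so the
    value 2, which marks matching type, is visible inside the piece. *)
Definition upgradable (Y : piece) SY LY : seq nat :=
  [seq i <- iota 0 (arity Y) | (i \notin LY) && (ldeg Y SY LY (leg Y i) == 2)].

Definition extendable (X Y : piece) SY LY ex : bool :=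
  has (fun SX => has (fun U => extends X Y ex SY LY SX U) (subseqs (upgradable Y SY LY)))
      (subseqs (edges X)).

(** [alts LY] lists cases of outer connectivity of which at least one holds for the tree at hand;
    which one is unknown, so each must admit an extension. *)
Definition reducible (X Y : piece) (alts : seq nat -> seq (seq (nat * nat))) : bool :=
  all (fun SY => all (fun LY =>
    if valid Y SY LY then all (extendable X Y SY LY) (alts LY) else true)
    (subseqs (iota 0 (arity Y)))) (subseqs (edges Y)).

Lemma wf_edges_sub n S E : subseq S E -> wf_edges n E -> wf_edges n S.
Proof.
move=> sub /andP[/allP bnd uE]; apply/andP; split.
  by apply/allP => p /(mem_subseq sub); exact: bnd.
by apply: subseq_uniq uE; apply: cat_subseq => //; apply: map_subseq.
Qed.

Lemma leg_lt P i : all (fun a => a < nverts P) (legs P) -> leg P i < nverts P.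
Proof.
by move=> /allP bnd; case: (ltnP i (arity P)) => H; [apply/bnd/mem_nth | rewrite nth_default].
Qed.

(** * Soundness of the lifting test *)

Section Extension.
Variables (R : finType) (eR : rel R) (lo : nat -> R) (X Y : piece).
Hypotheses (symR : symmetric eR) (eqk : arity X = arity Y).
Hypotheses (wfX : wf_piece X) (wfY : wf_piece Y).
Let k := arity X.
Hypotheses (legX : simple_legs lo X (iota 0 k)) (legY : simple_legs lo Y (iota 0 k)).
Let gX := glue lo X eR (edges X) (iota 0 k).
Let gY := glue lo Y eR (edges Y) (iota 0 k).
Hypothesis cubY : cubic gY.
Variables (FR : rel R) (SY : seq (nat * nat)) (LY : seq nat).
Hypotheses (subSY : subseq SY (edges Y)) (subLY : subseq LY (iota 0 k)).
Let FY := glue lo Y FR SY LY.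
Hypothesis treeY : balanced_tree gY FY.

Let symFR : symmetric FR.
Proof. by move=> r s; case: treeY => sF _ _ _ _; exact: (sF (inl r) (inl s)). Qed.

Let wX := proj1 (andP wfX).
Let lX := proj2 (andP wfX).
Let wY := proj1 (andP wfY).
Let lY := proj2 (andP wfY).
Let wSY := wf_edges_sub subSY wY.

Lemma simple_legs_sub P L L' : uniq L -> {subset L <= L'} -> simple_legs lo P L' ->
  simple_legs lo P L.
Proof. by move=> uL sub [_ inj]; split=> // i j /sub Li /sub Lj; exact: inj. Qed.

Let legLY : simple_legs lo Y LY.
Proof. exact: simple_legs_sub (subseq_uniq subLY (iota_uniq 0 k)) (mem_subseq subLY) legY. Qed.

Let LYk i : i \in LY -> i < k.
Proof. by move/(mem_subseq subLY); rewrite mem_iota. Qed.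

Let labY := wire_labels Y SY LY [::].

Lemma wires_bounded P S L ex : all (fun a => a < nverts P) (legs P) ->
  wf_edges (nverts P) S -> (forall i, i \in L -> i < arity P) ->
  (forall p, p \in ex -> p.1 < arity P /\ p.2 < arity P) ->
  bounded (nverts P + arity P) (wires P S L ex).
Proof.
move=> bnd /andP[/allP bS _] bL bex; rewrite /bounded !all_cat; apply/and3P; split.
- by apply/allP => p /bS /andP[p1 p2]; rewrite !ltn_addr.
- by rewrite all_map; apply/allP => i /bL /= ik; rewrite ltn_add2l ik andbT ltn_addr ?leg_lt.
- by rewrite all_map; apply/allP => p /bex /=; rewrite !ltn_add2l => -[-> ->].
Qed.

Let bndY : bounded (nverts Y + arity Y) (wires Y SY LY [::]).
Proof. by apply: wires_bounded => // i /LYk; rewrite /k eqk. Qed.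

Let labY_leg i : i \in LY -> nth 0 labY (leg Y i) = nth 0 labY (nverts Y + i).
Proof.
move=> Li; apply: (labels_complete (p := (leg Y i, nverts Y + i)) bndY).
by rewrite !mem_cat (map_f (fun i => (leg Y i, nverts Y + i)) Li) orbT.
Qed.

Let labY_edge (a b : 'I_(nverts Y)) : graph_of SY a b -> nth 0 labY a = nth 0 labY b.
Proof.
by case/orP => H; [|symmetry]; apply: (labels_complete (p := (_, _)) bndY);
   rewrite mem_cat H.
Qed.

Lemma valid_state : valid Y SY LY.
Proof.
have [_ _ cF _ bal] := treeY; apply/andP; split.
  apply/allP => -[a b] pE /=; have /andP[/allP/(_ _ pE)/andP[/= an bn] _] := wY.
  case pS : (_ \in SY) => //=; have := bal (inr (Ordinal an)) (inr (Ordinal bn)).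
  rewrite !deg_glue_inr //= => -> //; first by rewrite /graph_of /= pE.
  rewrite /graph_of /= pS /=; apply/negP => /(mem_subseq subSY) pE'.
  case/andP: wY => _; rewrite cat_uniq => /and3P[_ /hasPn disj _].
  by have := disj (a, b) (map_f flip pE'); rewrite /= pE.
apply/allP => y; rewrite mem_iota => /= yn.
have /connectP[p pth lst] := cF (inr (Ordinal yn)) (inl (lo 0)).
(* A tree path from an inner vertex to an outer one leaves the piece through a tree leg; the
   invariant records whether it has done so yet. *)
suff : forall u : R + 'I_(nverts Y), last (inr (Ordinal yn)) p = u ->
    match u with
    | inl _ => is_true (has (fun i => nth 0 labY y == nth 0 labY (nverts Y + i)) LY)
    | inr z => nth 0 labY y = nth 0 labY z \/ has (fun i => nth 0 labY y == nth 0 labY (nverts Y + i)) LY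
    end by move/(_ _ (esym lst)).
elim/last_ind: p pth {lst} => [|p v IH] /=; first by move=> _ u <-; left.
rewrite rcons_path last_rcons => /andP[/IH H Fv] u <- {u}.
have {}H := H _ erefl.
case: (last _ p) v H Fv => [r|a] [s|b] //=; try by right.
  case=> // H /hasP[i Li /andP[_ /eqP ia]]; apply/hasP; exists i => //.
  by rewrite H -ia labY_leg.
by case=> [H /labY_edge <-|]; [left|right].
Qed.

Variables (ex : seq (nat * nat)) (SX : seq (nat * nat)) (U : seq nat).
Hypotheses (exP : forall p, p \in ex -> [/\ p.1 < k, p.2 < k & connect FR (lo p.1) (lo p.2)])
  (subSX : subseq SX (edges X)) (subU : subseq U (upgradable Y SY LY))
  (ext : extends X Y ex SY LY SX U).
Let LX := LY ++ U.
Let FX := glue lo X FR SX LX.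
Let wSX := wf_edges_sub subSX wX.
Let labX := wire_labels X SX LX ex.

Let U_P i : i \in U -> [/\ i < k, i \notin LY & ldeg Y SY LY (leg Y i) = 2].
Proof.
move/(mem_subseq subU); rewrite mem_filter mem_iota => /andP[/andP[? /eqP ?] ?].
by split=> //; rewrite /k eqk.
Qed.

Let LXk i : i \in LX -> i < k.
Proof. by rewrite mem_cat => /orP[/LYk|/U_P[]]. Qed.

Let legLX : simple_legs lo X LX.
Proof.
apply: simple_legs_sub legX; last by move=> i /LXk; rewrite mem_iota.
rewrite cat_uniq (subseq_uniq subLY) ?iota_uniq //=; apply/andP; split.
  by apply/hasPn => i /U_P[].
by apply: subseq_uniq subU _; rewrite filter_uniq ?iota_uniq.
Qed.

Let bndX : bounded (nverts X + arity X) (wires X SX LX ex).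
Proof. by apply: wires_bounded => // p /exP[]. Qed.

Let symFX : symmetric FX. Proof. exact: glue_sym. Qed.

(** [node] reads a label index back as a vertex of the glued graph: below [nverts X] an inner
    vertex, from there on the outer end of a leg. *)
Let labX_connect (v w : nat) :
  let node v := if v < nverts X then inr (inord v) else inl (lo (v - nverts X)) in
  v < nverts X + k -> w < nverts X + k -> nth 0 labX v = nth 0 labX w ->
  connect FX (node v) (node w).
Proof.
move=> node.
apply: (labels_sound (E := fun v w => connect FX (node v) (node w))) => //.
- by move=> x y; rewrite (sym_connect_sym symFX).
- by move=> x y z; exact: connect_trans.
move=> p; rewrite !mem_cat /node => /or3P[pS|/mapP[i Li ->]|/mapP[q /exP[q1 q2 cq] ->]] /=.
- case/andP: wSX => /allP/(_ _ pS)/andP[-> ->] _.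
  case/andP: wSX => /allP/(_ _ pS)/andP[p1 p2] _.
  by apply: connect1; rewrite /FX /= /graph_of /= !inordK // -surjective_pairing pS.
- rewrite leg_lt // ltnNge leq_addr /= addKn.
  apply: connect1; apply/hasP; exists i => //=.
  by rewrite eqxx inordK ?leg_lt ?eqxx.
- rewrite !(ltnNge (_ + _)) !leq_addr /= !addKn.
  have /connectP[p' pth ->] := cq; elim: p' (lo q.1) pth {cq} => [|z p' IH] r /=.
    by rewrite connect0.
  by case/andP=> Frz /IH; apply: connect_trans; apply: connect1.
Qed.

Lemma extension_connected u v : connect FX u v.
Proof.
have := ext; rewrite /extends -/LX -/labX -/labY; do 3!(case: ifP => // _).
case/andP=> /allP ref /allP cov.
have out i : i < k -> (if nverts X + i < nverts X then inr (inord (nverts X + i)) else inl (lo (nverts X + i - nverts X))) = inl (lo i) :> R + 'I_(nverts X).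
  by move=> _; rewrite ltnNge leq_addr /= addKn.
have legs_conn i j : i < k -> j < k -> nth 0 labY (nverts Y + i) = nth 0 labY (nverts Y + j) ->
    connect FX (inl (lo i)) (inl (lo j)).
  move=> ik jk H; rewrite -(out i ik) -(out j jk); apply: labX_connect; rewrite ?ltn_add2l //.
  have /ref/allP/(_ j) : i \in iota 0 (arity X) by rewrite mem_iota.
  by rewrite mem_iota H eqxx => /(_ jk)/eqP.
have [_ _ cF _ _] := treeY.
(* Invariant along a walk of [FY] from [r]: an outer vertex is reached in [FX] as well. An inner
   vertex of [Y] has no counterpart in [X], so it is represented by a tree leg with the same label
   whose outer end is reached. *)
have claim r (w : R + 'I_(nverts Y)) : connect FY (inl r) w ->
    match w with
    | inl s => is_true (connect FX (inl r) (inl s))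
    | inr y => exists i, [/\ i \in LY, connect FX (inl r) (inl (lo i)) &
                  nth 0 labY y = nth 0 labY (nverts Y + i)]
    end.
  case/connectP=> p; elim/last_ind: p w => [|p w IH] w' /=.
    by move=> _ ->; exact: connect0.
  rewrite rcons_path last_rcons => /andP[/IH H Fw] -> {w'}.
  have {}H := H _ erefl.
  case: (last _ p) w H Fw => [s|a] [t|b] //= H.
  - by move=> st; apply: connect_trans H (connect1 _).
  - by case/hasP=> i Li /andP[/eqP is_ /eqP ib]; exists i; rewrite is_ -ib labY_leg.
  - case/hasP=> j Lj /andP[/eqP <- /eqP jb]; case: H => i [Li ci li].
    apply: connect_trans ci _; apply: legs_conn; rewrite ?LYk //.
    by rewrite -li -jb labY_leg.
  - move/labY_edge => ab; case: H => i [Li ci li]; exists i; split=> //.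
    by rewrite -ab.
suff root w : connect FX (inl (lo 0)) w.
  by apply: connect_trans (root v); rewrite (sym_connect_sym symFX).
case: w => [r|a]; first exact: (claim _ (inl r)).
have /cov/hasP[i] : val a \in iota 0 (nverts X) by rewrite mem_iota /=.
rewrite mem_iota => /= ik /eqP H.
have := @labX_connect a (nverts X + i) _ _ H.
rewrite /= ltn_ord inord_val out // ltn_add2l => /(_ (ltn_addr _ (ltn_ord a)) ik).
rewrite (sym_connect_sym symFX); apply: connect_trans.
exact: (claim _ (inl (lo i))).
Qed.

Let two_nontree r u w : gY (inl r) u -> gY (inl r) w -> ~~ FY (inl r) u -> ~~ FY (inl r) w ->
  deg FY (inl r) = 2 -> u = w.
Proof.
move=> gu gw nu nw d2; apply/eqP/negPn/negP => uw.
have [_ subF _ _ _] := treeY.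
have := cubic_split cubY (inl r) subF; rewrite d2 (bigD1 u) // (bigD1 w); last by rewrite /= eq_sym.
by rewrite gu gw nu nw.
Qed.

Let leg_nontree i : i < k -> i \notin LY ->
  gY (inl (lo i)) (inr (inord (leg Y i))) /\ ~~ FY (inl (lo i)) (inr (inord (leg Y i))).
Proof.
move=> ik iL; split; first by apply/hasP; exists i; rewrite ?mem_iota //= inordK ?eqxx // leg_lt.
apply/hasPn => j Lj; apply/negP => /andP[/eqP lij /eqP]; rewrite inordK ?leg_lt // => legij.
case: legY => _ inj; have E : j = i by apply: inj => //; rewrite mem_iota //= LYk.
by rewrite -E Lj in iL.
Qed.

Let leg_deg i : i < k -> i \notin LY -> deg FY (inl (lo i)) = ldeg Y SY LY (leg Y i).
Proof.
move=> ik iL; have [g n] := leg_nontree ik iL; have [_ _ _ _ bal] := treeY.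
by rewrite (bal _ _ g n) deg_glue_inr // inordK // leg_lt.
Qed.

Let upgraded_only i w : i \in U -> gY (inl (lo i)) w -> ~~ FY (inl (lo i)) w ->
  w = inr (inord (leg Y i)).
Proof.
case/U_P=> ik iL d2 gw nw; have [g n] := leg_nontree ik iL.
by apply: two_nontree gw g nw n _; rewrite leg_deg.
Qed.

Let deg_same r : (forall i, i \in U -> lo i <> r) -> deg FX (inl r) = deg FY (inl r).
Proof.
move=> nU; rewrite !deg_glue_inl // count_cat; congr (_ + _).
rewrite -[RHS]addn0; congr (_ + _); apply/eqP; rewrite -leqn0 leqNgt -has_count.
by apply/hasPn => i /nU/eqP.
Qed.

Lemma extension : balanced_tree gX FX.
Proof.
have [sF subF cF nF bal] := treeY.
have := ext; rewrite /extends -/LX.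
case: ifP => // /eqP count_ok; case: ifP => // /allP balX; case: ifP => // /allP leg_ok _.
have leg_bal r a : gX (inl r) (inr a) -> ~~ FX (inl r) (inr a) -> deg FX (inl r) = deg FX (inr a).
  case/hasP=> i; rewrite mem_iota => /= ik /andP[/eqP lir /eqP lia] /hasPn nF'.
  have iLX : i \notin LX by apply/negP => /nF'; rewrite lir lia !eqxx.
  have iLY : i \notin LY by apply: contra iLX; rewrite mem_cat => ->.
  have [gi ni] := leg_nontree ik iLY.
  rewrite deg_same; last first.
    (* An upgraded leg at [r] would be the only non-tree edge of [FY] there, hence equal to leg [i],
       which is not in [LX]. *)
    move=> j Uj lj; have [jk jL _] := U_P Uj.
    have := upgraded_only (w := inr (inord (leg Y i))) Uj.
    rewrite lj -lir => /(_ gi ni) [] /(congr1 val) /=; rewrite !inordK ?leg_lt // => legij.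
    case: legY => _ inj; case/negP: iLX; rewrite (inj i j) ?mem_iota ?lir //.
    by rewrite mem_cat Uj orbT.
  rewrite -lir leg_deg // deg_glue_inr // -lia.
  have := leg_ok i; rewrite mem_iota (negbTE iLX) /= => /(_ ik)/eqP ->.
  by [].
split=> //.
- move=> [r|a] [s|b] /=; first exact: (subF (inl r) (inl s)).
  + by case/hasP=> i Li H; apply/hasP; exists i; rewrite ?mem_iota ?LXk.
  + by case/hasP=> i Li H; apply/hasP; exists i; rewrite ?mem_iota ?LXk.
  + by case/orP=> /(mem_subseq subSX) H; rewrite /graph_of H ?orbT.
- exact: extension_connected.
- move: nF; rewrite !ecount_glue // !card_sum !card_ord; move: count_ok; rewrite -/LX.
  move: (ecount FR) (size SX) (size LX) (size SY) (size LY) #|R| (top X) (top Y).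
  by clear; lia.
- move=> [r|a] [s|b].
  + move=> /= grs nrs.
    have noU i t1 t2 : eR t1 t2 -> ~~ FR t1 t2 -> i \in U -> lo i <> t1.
      by move=> g n Ui lit; have := @upgraded_only i (inl t2) Ui; rewrite lit => /(_ g n).
    rewrite !deg_same; first exact: bal (inl r) (inl s) grs nrs.
    * by move=> i; apply: (noU i s r); rewrite 1?symR // symFR.
    * by move=> i; apply: (noU i r s).
  + exact: leg_bal.
  + by move=> g n; symmetry; apply: leg_bal.
  + rewrite !deg_glue_inr //= /graph_of => gab; rewrite negb_or => /andP[n1 n2].
    case/orP: gab => /balX /=; rewrite ?(negbTE n1) ?(negbTE n2) /= => /eqP //.
Qed.

End Extension.

(** * Reductions *)

Definition treelike (T : finType) (e : rel T) : Prop := exists F, balanced_tree e F.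

(** Minimality is put in terms of cuts and balanced trees, and only for nonempty smaller graphs, the
    case covered by the equivalences with 3-connectedness and decompositions. *)
Definition minimal (T : finType) (e : rel T) : Prop :=
  [/\ simple_graph e, cubic e, cut3 e, ~ treelike e &
      forall (U : finType) (h : rel U), simple_graph h -> cubic h -> cut3 h ->
        0 < #|U| -> #|U| < #|T| -> treelike h].

Section Transport.
Variables (T U : finType) (e : rel T) (h : rel U) (g : U -> T).
Hypotheses (bij : bijective g) (eh : forall x y, e (g x) (g y) = h x y).

Lemma deg_iso (F : rel T) x : deg F (g x) = deg (fun u v => F (g u) (g v)) x.
Proof. by rewrite !degE (reindex g) //; exact: onW_bij. Qed.

Lemma treelike_iso : treelike h -> treelike e.
Proof.
case: bij => g' gK g'K [F [sF subF cF nF bal]].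
pose F' : rel T := fun x y => F (g' x) (g' y).
have F'g u v : F' (g u) (g v) = F u v by rewrite /F' !gK.
exists F'; split.
- by move=> x y; rewrite /F' sF.
- by move=> x y /subF; rewrite -eh !g'K.
- move=> x y; rewrite -(g'K x) -(g'K y).
  have /connectP[p pth ->] := cF (g' x) (g' y); elim: p (g' x) pth => [|z p IH] u /=.
    by rewrite connect0.
  case/andP=> Fuz /IH; apply: connect_trans; apply: connect1.
  by rewrite F'g.
- rewrite -(bij_eq_card bij) -nF; congr (_ + _); rewrite /ecount (reindex g) /=; last exact: onW_bij.
  apply: eq_bigr => u _; rewrite (reindex g) /=; last exact: onW_bij.
  by apply: eq_bigr => v _; rewrite F'g.
- move=> x y; rewrite -(g'K x) -(g'K y) eh F'g => hxy nF'; have := bal _ _ hxy nF'.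
  by rewrite !deg_iso !degE => H; rewrite (eq_bigr _ (fun v _ => congr1 nat_of_bool (F'g _ v))) H; apply: eq_bigr => v _; rewrite F'g.
Qed.

Lemma minimal_iso : minimal e -> minimal h.
Proof.
case=> -[syme irre] cube cut3e nt small; split.
- by split=> [u v|u]; rewrite -!eh // syme.
- by move=> u; rewrite -(cube (g u)) deg_iso !degE; apply: eq_bigr => v _; rewrite eh.
- move=> A [u Au] [v Av]; case: (bij) => g' gK g'K.
  have := cut3e (fun x => A (g' x)) (ex_intro _ (g u) _) (ex_intro _ (g v) _); rewrite !gK => /(_ Au Av).
  rewrite /cut (reindex g) /=; last exact: onW_bij.
  rewrite (eq_bigr (fun u => \sum_v [&& A u, ~~ A v & h u v])) // => a _.
  rewrite (reindex g) /=; last exact: onW_bij.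
  by apply: eq_bigr => b _; rewrite !gK eh.
- by move/treelike_iso.
- by rewrite (bij_eq_card bij).
Qed.

End Transport.

(** * Edge cuts after a replacement *)

Fixpoint bool_seqs (n : nat) : seq (seq bool) :=
  if n is n'.+1 then let r := bool_seqs n' in map (cons true) r ++ map (cons false) r
  else [:: [::]].

Lemma bool_seqsP n (s : seq bool) : size s = n -> s \in bool_seqs n.
Proof.
elim: n s => [|n IH] [|b s] //= [/IH H].
by rewrite mem_cat; case: b; rewrite map_f ?orbT.
Qed.

Definition piece_cut (P : piece) (l b : seq bool) : nat :=
  count (fun p => nth false b p.1 != nth false b p.2) (edges P)
  + count (fun i => nth false l i != nth false b (leg P i)) (iota 0 (arity P)).

(* [l] and [b] list the sides on which the outer ends of the legs and the vertices of the
   piece lie; splitting the legs along [weak] is allowed to cost a single edge. *)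
Definition cut_ok (P : piece) (weak : seq (seq bool)) : bool :=
  all (fun l => all (fun b =>
     let c := piece_cut P l b in
     [&& (has id l || ~~ has id b || (3 <= c)),
         (~~ all id l || all id b || (3 <= c)) &
         if l \in weak then 0 < c else minn (count id l) (count negb l) <= c])
     (bool_seqs (nverts P))) (bool_seqs (arity P)).

Definition cubic_piece (P : piece) : bool :=
  all (fun a => ldeg P (edges P) (iota 0 (arity P)) a == 3) (iota 0 (nverts P)).

Definition sides (R : finType) (lo : nat -> R) k (A : pred R) : seq bool :=
  [seq A (lo i) | i <- iota 0 k].

Lemma nth_sides (R : finType) (lo : nat -> R) k (A : pred R) i :
  i < k -> nth false (sides lo k A) i = A (lo i).
Proof. by move=> ik; rewrite (nth_map 0) ?size_iota // nth_iota. Qed.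

Lemma uniq_legs (R : finType) (lo : nat -> R) P :
  uniq (legs P) -> simple_legs lo P (iota 0 (arity P)).
Proof.
move=> uJ; split; first exact: iota_uniq.
by move=> i j; rewrite !mem_iota => /= ik jk _ /eqP; rewrite nth_uniq // => /eqP.
Qed.

Section Reduction.
Variables (R : finType) (eR : rel R) (lo : nat -> R) (X Y : piece).
Hypotheses (symR : symmetric eR) (irrR : irreflexive eR) (eqk : arity X = arity Y).
Hypotheses (wfX : wf_piece X) (wfY : wf_piece Y) (uX : uniq (legs X)).
Let k := arity X.
Hypothesis legY : simple_legs lo Y (iota 0 k).
Let gX := glue lo X eR (edges X) (iota 0 k).
Let gY := glue lo Y eR (edges Y) (iota 0 k).
Variable weak : seq (seq bool).
Hypotheses (minX : minimal gX) (ltYX : top Y < top X).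
Hypotheses (cubY : cubic_piece Y) (cutY : cut_ok Y weak).
Hypothesis weakR : forall A : pred R, sides lo k A \in weak -> 2 <= cut eR A.

Let legX : simple_legs lo X (iota 0 k) := uniq_legs lo uX.
Let wX := proj1 (andP wfX).
Let lX := proj2 (andP wfX).
Let wY := proj1 (andP wfY).
Let lY := proj2 (andP wfY).

(** If a cut of [gY] splits the outer graph, it is compared with the two cuts of [gX] that agree
    with it outside and put all of [X] on one side. These pay for the outer ends on the one side or
    on the other, so it is enough that [Y] pays for the smaller number. For sides in [weak] the
    outer graph contributes two edges and the piece one. *)
Lemma glue_cut3 : cut3 gY.
Proof.
move=> A exA exnA; have [_ _ cutX _ _] := minX.
pose AR : pred R := fun r => A (inl r).
pose l := sides lo k AR.
pose b := mkseq (fun a => A (inr (inord a))) (nverts Y).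
have Ab a : A (inr a) = nth false b a by rewrite nth_mkseq // inord_val.
rewrite (cut_glue _ lY wY legY (b := nth false b)) // -addnA.
have -> : count (fun p => nth false b p.1 != nth false b p.2) (edges Y) +
  count (fun i => A (inl (lo i)) != nth false b (leg Y i)) (iota 0 k) = piece_cut Y l b.
  rewrite /piece_cut -eqk; congr (_ + _); apply: eq_in_count => i.
  by rewrite mem_iota => /= ik; rewrite nth_sides.
have szl : size l = arity Y by rewrite size_map size_iota -eqk.
have szb : size b = nverts Y by rewrite size_mkseq.
have /and3P[c0 c1 cm] := allP (allP cutY l (bool_seqsP szl)) b (bool_seqsP szb).
have [/existsP[r Ar]|/existsPn nA] := boolP [exists r, AR r]; last first.
  suff : 3 <= piece_cut Y l b by exact: ltn_addl.
  have hl : ~~ has id l by apply/hasPn => x /mapP[i _ ->]; exact: nA.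
  have hb : has id b.
    case: exA => -[r Ar|a Aa]; first by have := nA r; rewrite /AR Ar.
    by apply/hasP; exists (A (inr a)) => //; rewrite Ab mem_nth ?szb.
  by move: c0; rewrite (negbTE hl) hb.
have [/existsP[s As]|/existsPn nA] := boolP [exists r, ~~ AR r]; last first.
  suff : 3 <= piece_cut Y l b by exact: ltn_addl.
  have al : all id l by apply/allP => x /mapP[i _ ->]; have := nA (lo i); rewrite negbK.
  have ab : ~~ all id b.
    case: exnA => -[s As|a Aa]; first by have := nA s; rewrite /AR As.
    by apply/allPn; exists (A (inr a)) => //; rewrite Ab mem_nth ?szb.
  by move: c1; rewrite al (negbTE ab).
have outer c : 3 <= cut eR AR + count (fun x => x != c) l.
  have := cutX (fun u => if u is inl r then AR r else c) (ex_intro _ (inl r) Ar) (ex_intro _ (inl s) As).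
  rewrite (cut_glue _ lX wX legX (b := fun=> c)) // => H.
  apply: leq_trans H _; rewrite -addnA leq_add2l.
  rewrite (eq_count (a2 := pred0)) ?count_pred0 ?add0n => [|p]; last by rewrite /= eqxx.
  by rewrite /l /sides count_map.
have o0 := outer false; have o1 := outer true.
have e0 : count (fun x => x != false) l = count id l by apply: eq_count => -[].
have e1 : count (fun x => x != true) l = count negb l by apply: eq_count => -[].
rewrite e0 e1 in o0 o1.
move: cm; case: ifP => [/weakR H cm|_ cm].
  exact: leq_add H cm.
by move: cm; rewrite geq_min => /orP[H|H]; [apply: leq_trans o0 _ | apply: leq_trans o1 _]; rewrite leq_add2l.
Qed.

Lemma glue_cubic : cubic gY.
Proof.
have [_ cubX _ _ _] := minX.
move=> [r|a]; last first.
  rewrite deg_glue_inr // /k eqk.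
  by have /allP/(_ (val a))/(_ _)/eqP := cubY; apply; rewrite mem_iota /=.
by have := cubX (inl r); rewrite !deg_glue_inl.
Qed.

Lemma reduction (alts : seq nat -> seq (seq (nat * nat))) :
  reducible X Y alts ->
  (forall F, balanced_tree gY F ->
     exists2 ex, ex \in alts [seq i <- iota 0 k | F (inl (lo i)) (inr (inord (leg Y i)))] &
       forall p, p \in ex ->
         [/\ p.1 < k, p.2 < k & connect (fun r s => F (inl r) (inl s)) (lo p.1) (lo p.2)]) ->
  False.
Proof.
have [_ _ _ nt small] := minX.
move=> /allP red outer; apply: nt.
have [|||F tF] := small _ gY _ glue_cubic glue_cut3.
- by split; [exact: glue_sym | exact: glue_irr].
- by apply/card_gt0P; exists (inl (lo 0)).
- by rewrite !card_sum !card_ord ltn_add2l ltnS.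
have [ex exin exP] := outer F tF.
move: exin exP; set FR : rel R := fun r s => F (inl r) (inl s).
set LY := [seq i <- _ | _] => exin exP.
pose SY := [seq p <- edges Y | F (inr (inord p.1)) (inr (inord p.2))].
have [sF subF cF nF bal] := tF.
have FE : F =2 glue lo Y FR SY LY by exact: (glue_sub sF subF).
have tF' : balanced_tree gY (glue lo Y FR SY LY).
  have dE x : deg F x = deg (glue lo Y FR SY LY) x.
    by rewrite !degE; apply: eq_bigr => y _; rewrite FE.
  split.
  - by move=> x y; rewrite -!FE sF.
  - by move=> x y; rewrite -FE; exact: subF.
  - by move=> x y; rewrite -(eq_connect FE).
  - rewrite -nF; congr (_ + _); rewrite /ecount.
    by apply: eq_bigr => x _; apply: eq_bigr => y _; rewrite FE.
  - by move=> x y; rewrite -FE -!dE; exact: bal.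
have subS : subseq SY (edges Y) := filter_subseq _ _.
have subL : subseq LY (iota 0 k) := filter_subseq _ _.
have /allP/(_ LY) := red SY (filter_subseqs _ _).
rewrite (valid_state eqk wfY legY subS subL tF').
rewrite -eqk => /(_ (filter_subseqs _ _))/allP/(_ ex exin)/hasP[SX /subseqsP subX /hasP[U /subseqsP subU ext]].
exists (glue lo X FR SX (LY ++ U)).
exact: (extension symR eqk wfX wfY legX legY glue_cubic subS subL tF' exP subX subU ext).
Qed.

End Reduction.

(** * The pieces *)

Definition star := Piece 0 [::] [:: 0; 0; 0].
Definition bar := Piece 1 [:: (0,1)] [:: 0; 0; 1; 1].
Definition square := Piece 3 [:: (0,1); (1,2); (2,3); (3,0)] [:: 0; 1; 2; 3].

Definition triangle_piece := Piece 2 [:: (0,1); (1,2); (2,0)] [:: 0; 1; 2].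
Definition K23_piece := Piece 4 [:: (0,2); (0,3); (0,4); (1,2); (1,3); (1,4)] [:: 2; 3; 4].
(** Vertex 0 of the Petersen graph is removed and the others are shifted down by one; the legs sit
    at its former neighbours 1, 4 and 5. *)
Definition petersen_piece := Piece 8
  [:: (0,1); (1,2); (2,3); (0,5); (1,6); (2,7); (3,8); (4,6); (6,8); (8,5); (5,7); (7,4)]
  [:: 0; 3; 4].
Definition claw_square_piece := Piece 7
  [:: (0,1); (1,2); (2,3); (3,0); (7,4); (7,5); (7,6); (4,0); (5,1); (6,2)] [:: 3; 4; 5; 6].
(* Leg [i] is attached to vertex [i] of the replacing square, so this order puts the ends of
   the edge [p1p2] at opposite corners; with adjacent corners the lifting check fails. *)
Definition twin_house_piece := Piece 5
  [:: (0,1); (0,4); (1,5); (4,2); (4,3); (5,2); (5,3)] [:: 0; 2; 1; 3].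
(** The legs follow the boundary: 0 and 1 sit at the ends of one row, 2 and 3 at the ends of the
    other. So [bar] contracts each row to a vertex, and [square] keeps the cyclic order of the four
    corners. *)
Definition domino_piece := Piece 5
  [:: (0,1); (1,2); (3,4); (4,5); (0,3); (1,4); (2,5)] [:: 0; 2; 5; 3].

Definition no_alts (LY : seq nat) : seq (seq (nat * nat)) := [:: [::]].

(** If the tree enters [square] only by the two legs of one row, the outer ends of the other row
    reach the piece only across the bridge. They are then joined outside to each other and to one of
    the outer ends of the first row. *)
Definition domino_alts (LY : seq nat) : seq (seq (nat * nat)) :=
  if LY == [:: 0; 1] then [:: [:: (2,3); (2,0)]; [:: (2,3); (2,1)]]
  else if LY == [:: 2; 3] then [:: [:: (0,1); (0,2)]; [:: (0,1); (0,3)]]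
  else [:: [::]].

(** On these sides [bar] can be cut at its single edge, although two legs end on either side; the
    outer graph must then contribute two edges. *)
Definition row_split : seq (seq bool) :=
  [:: [:: true; true; false; false]; [:: false; false; true; true]].

Lemma reducible_triangle : reducible triangle_piece star no_alts. Proof. by vm_compute. Qed.
Lemma reducible_K23 : reducible K23_piece star no_alts. Proof. by vm_compute. Qed.
Lemma reducible_claw_square : reducible claw_square_piece square no_alts. Proof. by vm_compute. Qed.
Lemma reducible_twin_house : reducible twin_house_piece square no_alts. Proof. by vm_compute. Qed.
Lemma reducible_domino_bar : reducible domino_piece bar no_alts. Proof. by vm_compute. Qed.
Lemma reducible_domino_square : reducible domino_piece square domino_alts. Proof. by vm_compute. Qed.
Lemma cut_ok_star : cut_ok star [::]. Proof. by vm_compute. Qed.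
Lemma cut_ok_square : cut_ok square [::]. Proof. by vm_compute. Qed.
Lemma cut_ok_bar : cut_ok bar row_split. Proof. by vm_compute. Qed.
Lemma reducible_petersen : reducible petersen_piece star no_alts. Proof. by vm_compute. Qed.

(** * Subgraphs that cover the whole graph *)

Definition tree_search (n : nat) (E : seq (nat * nat)) : bool :=
  has (fun S =>
    if size S == n then
    if all (pred1 (nth 0 (labels n.+1 S) 0)) (labels n.+1 S) then
      balanced_edges (Piece n E [::]) S [::]
    else false else false) (subseqs E).

Lemma tree_searchP n E : wf_edges n.+1 E -> tree_search n E -> treelike (@graph_of n.+1 E).
Proof.
move=> wE /hasP[S /subseqsP subS]; case: ifP => // /eqP szS; case: ifP => // /allP lab bal.
have wS := wf_edges_sub subS wE.
have subG : subrel (@graph_of n.+1 S) (@graph_of n.+1 E).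
  by move=> a b; rewrite /graph_of => /orP[] /(mem_subseq subS) ->; rewrite ?orbT.
have bndS : bounded n.+1 S by case/andP: wS.
exists (graph_of S); split=> //.
- exact: graph_of_sym.
- move=> a b; rewrite -(inord_val a) -(inord_val b).
  apply: (labels_sound (E := fun v w => connect (@graph_of n.+1 S) (inord v) (inord w)) _ _ _ bndS _ (ltn_ord a) (ltn_ord b)) => //.
  + by move=> x y; rewrite (sym_connect_sym (@graph_of_sym _ _)).
  + by move=> x y z; exact: connect_trans.
  + move=> [u v] pS; apply: connect1; have /andP[ul vl] := allP bndS _ pS.
    by rewrite /graph_of /= !inordK // pS.
  + have szl : size (labels n.+1 S) = n.+1.
      rewrite /labels -[RHS](size_iota 0); elim: S (iota _ _) {wS subG bndS lab bal szS subS} => //= p S IH l.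
      by rewrite IH size_merge_labels.
    have lb (c : 'I_n.+1) : nth 0 (labels n.+1 S) c = nth 0 (labels n.+1 S) 0.
      by apply/eqP; apply: lab; rewrite mem_nth // szl.
    by rewrite !lb.
- by rewrite ecount_graph_of // szS card_ord mulnS addnC.
- move=> a b gab; rewrite negb_or => /andP[n1 n2]; rewrite !deg_graph_of //.
  by case/orP: gab => /(allP bal); rewrite /= ?(negbTE n1) ?(negbTE n2) /ldeg /= !addn0 => /eqP.
Qed.

Fixpoint pairs (s : seq nat) : seq (nat * nat) :=
  if s is x :: s' then map (pair x) s' ++ pairs s' else [::].

Lemma pairsP s x y : x \in s -> y \in s -> x != y -> ((x, y) \in pairs s) || ((y, x) \in pairs s).
Proof.
elim: s => [|z s IH] //=; rewrite !inE !mem_cat => /predU1P[->|xs] /predU1P[->|ys].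
- by rewrite eqxx.
- by rewrite map_f.
- by rewrite map_f ?orbT.
- by move=> /(IH xs ys)/orP[] ->; rewrite ?orbT.
Qed.

Lemma mem_pairs s p : p \in pairs s -> (p.1 \in s) && (p.2 \in s).
Proof.
elim: s => [|z s IH] //=; rewrite mem_cat => /orP[/mapP[u us ->]|/IH/andP[]] /=.
  by rewrite !inE eqxx us orbT.
by rewrite !inE => -> ->; rewrite !orbT.
Qed.

Lemma pairs_uniq s : uniq s -> uniq (pairs s ++ map flip (pairs s)).
Proof.
have fK : injective flip by move=> [a b] [c d] [-> ->].
have upairs t : uniq t -> uniq (pairs t).
  elim: t => [|z t IH] //= /andP[zt ut]; rewrite cat_uniq IH // andbT map_inj_uniq ?ut => [|u v [] //].
  by apply/hasPn => p /mem_pairs/andP[p1 _]; apply/mapP => -[u _ E]; rewrite E /= (negbTE zt) in p1.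
move=> us; rewrite cat_uniq upairs // map_inj_uniq // upairs // andbT /=.
apply/hasPn => p /mapP[q qs ->]; apply/negP => fq.
elim: s us qs fq => [|z s IH] //= /andP[zs us]; rewrite !mem_cat.
case/orP=> [/mapP[u us' ->]|qs] /orP[/mapP[v vs [E1 E2]]|fs].
- by rewrite E1 (negbTE zs) in us'.
- by have /andP[_] := mem_pairs fs; rewrite /= (negbTE zs).
- by have /andP[_] := mem_pairs qs; rewrite E1 (negbTE zs).
- exact: IH.
Qed.

(** If the piece covers the graph, the edges missing at its leg vertices join these vertices among
    themselves. The check finds a balanced tree in every such cubic completion. *)
Definition whole_check (P : piece) : bool :=
  all (fun M => let E := edges P ++ M in
     if wf_edges (nverts P) E &&
        all (fun a => count (fun p => p.1 == a) E + count (fun p => p.2 == a) E == 3)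
          (iota 0 (nverts P))
     then tree_search (top P) E else true) (subseqs (pairs (legs P))).

Lemma count_leg P a : uniq (legs P) ->
  count (fun i => leg P i == a) (iota 0 (arity P)) = (a \in legs P).
Proof.
move=> uJ; rewrite -(count_uniq_mem _ uJ) -[in RHS](mkseq_nth 0 (legs P)) /mkseq count_map.
exact: eq_count.
Qed.

Section Extra.
Variables (R : finType) (P : piece) (h : rel (R + 'I_(nverts P))).
Hypotheses (minh : minimal h) (wfP : wf_piece P) (uP : uniq (legs P)) (cubP : cubic_piece P).
Hypothesis sub : forall a b, graph_of (edges P) a b -> h (inr a) (inr b).

Definition extra (a b : 'I_(nverts P)) := h (inr a) (inr b) && ~~ graph_of (edges P) a b.

(** A leg vertex has degree 2 in the piece and any other vertex degree 3; so exactly one edge at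
    each leg vertex is undetermined, and it goes outside or is an extra edge. *)
Lemma extra_deg a :
  \sum_r h (inr a) (inl r) + \sum_b extra a b = (val a \in legs P).
Proof.
have [wP lP] := andP wfP; have [_ cub _ _ _] := minh.
have /allP/(_ (val a)) := cubP; rewrite mem_iota /ldeg count_leg // => /(_ (ltn_ord a))/eqP.
rewrite -(deg_graph_of a wP) degE -(cub (inr a)) degE big_sumType /=.
suff -> : \sum_b h (inr a) (inr b) = \sum_b graph_of (edges P) a b + \sum_b extra a b.
  by move: (\sum_(b < _) graph_of _ _ _) => x H; apply/eqP; rewrite -(eqn_add2l x) H addnCA.
rewrite -big_split; apply: eq_bigr => b _ /=; rewrite /extra.
by have := @sub a b; case: (graph_of _ _ _) => [/(_ isT) ->|_]; rewrite ?andbT.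
Qed.

Lemma extra_sym : symmetric extra.
Proof.
have [[symh _] _ _ _ _] := minh.
by move=> a b; rewrite /extra symh [graph_of _ _ _]graph_of_sym.
Qed.

Lemma extra_neq a b : extra a b -> a != b.
Proof.
have [[_ irr] _ _ _ _] := minh.
by move=> /andP[hab _]; apply/eqP => E; rewrite E irr in hab.
Qed.

Lemma extra_leg a b : extra a b -> (val a \in legs P) && (val b \in legs P).
Proof.
have one x y : extra x y -> val x \in legs P.
  move=> xy; have := extra_deg x; rewrite (bigD1 y) //= xy.
  by case: (_ \in _) => //; rewrite addnC.
by move=> ab; rewrite (one a b ab) (one b a) // extra_sym.
Qed.

(** An extra edge would use up two of at most four legs and leave at most two edges between the
    piece and its nonempty outside. So every leg has an outer end. *)
Lemma glue_of : (exists r : R, True) -> arity P <= 4 ->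
  exists lo : nat -> R,
    h =2 glue lo P (fun r s => h (inl r) (inl s)) (edges P) (iota 0 (arity P)).
Proof.
move=> [r0 _] k4; have [wP lP] := andP wfP; have [[symh irrh] cub c3 _ _] := minh.
have cutP : 3 <= \sum_a \sum_r h (inr a) (inl r).
  have := c3 (fun u => if u is inr _ then true else false) (ex_intro _ (inr ord0) isT) (ex_intro _ (inl r0) isT).
  rewrite /cut big_sumType /= [X in X + _]big1 => [|r _]; last by rewrite big1.
  rewrite add0n => /leq_trans -> //; apply: leq_sum => a _.
  by rewrite big_sumType /= [X in _ + X]big1 ?addn0.
have tot : \sum_a \sum_r h (inr a) (inl r) + \sum_a \sum_b extra a b = arity P.
  rewrite -big_split /=; under eq_bigr => a _ do rewrite extra_deg -count_leg // -sum_count.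
  rewrite exchange_big -[RHS](size_iota 0 (arity P)) -[RHS]sum1_size; apply: eq_bigr => i _ /=.
  rewrite -[RHS](@sum_ord_eq (nverts P) (leg P i) (fun=> 1) (leg_lt i lP)).
  by apply: eq_bigr => a _; rewrite muln1.
have none a b : extra a b = false.
  apply/negP => ab.
  have : 2 <= \sum_a \sum_b extra a b.
    rewrite (bigD1 a) //= (bigD1 b) //= [X in _ + X](bigD1 b) /=; last by rewrite eq_sym extra_neq.
    by rewrite ab [X in _ + (X + _)](bigD1 a) //= [extra b a]extra_sym ab; clear; lia.
  by move: cutP tot k4; clear; lia.
have out a : \sum_r h (inr a) (inl r) = (val a \in legs P).
  by rewrite -extra_deg [X in _ + X]big1 ?addn0 // => b _; rewrite none.
(* For [i < arity P] the choice succeeds by [loP]; [r0] fills the remaining indices. *)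
pose lo i := odflt r0 [pick r | h (inr (inord (leg P i))) (inl r)].
have loP i : i < arity P -> h (inr (inord (leg P i))) (inl (lo i)).
  move=> ik; rewrite /lo; case: pickP => // H.
  have := out (inord (leg P i)); rewrite /= inordK ?leg_lt // mem_nth //.
  by rewrite big1 // => r _; rewrite H.
exists lo => -[r|a] [s|b] //=.
- rewrite symh; apply/idP/hasP => [hbr|[i]]; last first.
    by rewrite mem_iota => /= ik /andP[/eqP <- /eqP ib]; have := loP i ik; rewrite ib inord_val.
  have bl : val b \in legs P.
    by have := out b; rewrite (bigD1 r) //= hbr; case: (_ \in _) => //.
  exists (index (val b) (legs P)); first by rewrite mem_iota /= index_mem.
  have := loP (index (val b) (legs P)); rewrite index_mem nth_index // inord_val => /(_ bl) hbl.
  rewrite eqxx andbT; apply/negPn/negP => ne.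
  have := out b; rewrite bl (bigD1 r) //= (bigD1 (lo (index (val b) (legs P)))) //= hbl hbr.
  by [].
- apply/idP/hasP => [hbr|[i]]; last first.
    by rewrite mem_iota => /= ik /andP[/eqP <- /eqP ib]; have := loP i ik; rewrite ib inord_val.
  have bl : val a \in legs P.
    by have := out a; rewrite (bigD1 s) //= hbr; case: (_ \in _) => //.
  exists (index (val a) (legs P)); first by rewrite mem_iota /= index_mem.
  have := loP (index (val a) (legs P)); rewrite index_mem nth_index // inord_val => /(_ bl) hbl.
  rewrite eqxx andbT; apply/negPn/negP => ne.
  have := out a; rewrite bl (bigD1 s) //= (bigD1 (lo (index (val a) (legs P)))) //= hbl hbr.
  by [].
- have := none a b; rewrite /extra; have := @sub a b.
  by case: (graph_of _ _ _) => [/(_ isT) ->|_]; [|rewrite andbT].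
Qed.

Lemma not_whole : (R -> False) -> whole_check P -> False.
Proof.
move=> noR chk; have [wP lP] := andP wfP; have [[symh irrh] cub c3 nt _] := minh.
pose M := [seq p <- pairs (legs P) | extra (inord p.1) (inord p.2)].
have MP a b : graph_of M a b = extra a b.
  rewrite /graph_of !mem_filter /= !inord_val [extra b a]extra_sym -andb_orr.
  case ab : (extra a b) => //=; have /andP[la lb] := extra_leg ab.
  by apply: pairsP => //; exact: extra_neq ab.
have hE a b : h (inr a) (inr b) = graph_of (edges P ++ M) a b.
  have -> : graph_of (edges P ++ M) a b = graph_of (edges P) a b || graph_of M a b.
    by rewrite /graph_of !mem_cat orbACA.
  rewrite MP /extra; have := @sub a b.
  by case: (graph_of _ _ _) => [/(_ isT) ->|_]; rewrite ?andbT.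
have wEM : wf_edges (nverts P) (edges P ++ M).
  have Mb p : p \in M -> [/\ p.1 < nverts P, p.2 < nverts P & extra (inord p.1) (inord p.2)].
    rewrite mem_filter => /andP[ep /mem_pairs/andP[p1 p2]].
    by split=> //; apply: (allP lP).
  apply/andP; split.
    apply/allP => p; rewrite mem_cat => /orP[pE|/Mb[-> ->] //].
    by case/andP: wP => /allP/(_ _ pE).
  rewrite map_cat (perm_uniq (_ : perm_eq _ ((edges P ++ map flip (edges P)) ++ (M ++ map flip M)))); last first.
    by rewrite perm_catACA.
  rewrite cat_uniq; apply/and3P; split; first by case/andP: wP.
    apply/hasPn => p; rewrite !mem_cat.
    have key (q : nat * nat) : q \in M -> (q \notin edges P) && (flip q \notin edges P).
      by case/Mb => q1 q2 /andP[_]; rewrite /graph_of /= !inordK // negb_or -surjective_pairing.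
    rewrite negb_or => /orP[/key/andP[-> fp]|/mapP[q /key/andP[q1 q2] ->]] /=.
      by apply/mapP => -[q qE E]; rewrite E /flip /= -surjective_pairing qE in fp.
    rewrite q2 /=; apply/mapP => -[[x y] qE]; case: (q) q1 => a b q1 [E1 E2].
    by rewrite -E1 -E2 in qE; rewrite qE in q1.
  apply: subseq_uniq (pairs_uniq uP).
  by apply: cat_subseq; [|apply: map_subseq]; exact: filter_subseq.
have degE' a : deg h (inr a) = deg (@graph_of (nverts P) (edges P ++ M)) a.
  rewrite !degE big_sumType /= big1 ?add0n => [|r]; last by case: (noR r).
  by apply: eq_bigr => b _; rewrite hE.
have := allP chk M (filter_subseqs _ _); cbv beta zeta; case: ifP => [_|/negP[]]; last first.
  rewrite wEM; apply/allP => a; rewrite mem_iota => /= an.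
  by have := deg_graph_of (Ordinal an) wEM; rewrite -degE' cub /= => <-.
move/(tree_searchP wEM) => tG; apply: nt.
apply: (treelike_iso (g := @inr R 'I_(nverts P))) tG => //.
exists (fun u => if u is inr a then a else ord0) => // -[r|//].
by case: (noR r).
Qed.

End Extra.

Definition good_piece (P : piece) : bool :=
  [&& wf_piece P, uniq (legs P), cubic_piece P, arity P <= 4 & whole_check P].

Lemma minimal_eq (T : finType) (e h : rel T) : e =2 h -> minimal e -> minimal h.
Proof. by move=> eh; apply: (@minimal_iso _ _ _ _ id) => //; exists id. Qed.

(** * Splitting the graph along an embedded subgraph *)

Section Embedding.
Variables (T : finType) (e : rel T) (P : piece) (f : 'I_(nverts P) -> T).
Hypotheses (mine : minimal e) (hom : forall a b, graph_of (edges P) a b -> e (f a) (f b)).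
Hypotheses (wfP : wf_piece P) (uP : uniq (legs P)) (cubP : cubic_piece P) (chk : whole_check P).

Lemma no_spanning_piece : bijective f -> False.
Proof.
(* Taking [void] as the outer part puts the graph in the form required by [not_whole]. *)
move=> [f' fK f'K]; pose g (u : void + 'I_(nverts P)) := if u is inr a then f a else f ord0.
have minh : minimal (fun u v => e (g u) (g v)).
  apply: minimal_iso mine => //; exists (fun x => inr (f' x)) => [[//|a]|x] /=; last exact: f'K.
  by rewrite fK.
by apply: (not_whole minh wfP uP cubP _ _ chk) => //.
Qed.

Lemma embed_glue : injective f -> arity P <= 4 ->
  exists (R : finType) (eR : rel R) (lo : nat -> R),
    [/\ symmetric eR, irreflexive eR & minimal (glue lo P eR (edges P) (iota 0 (arity P)))].
Proof.
move=> injf k4.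
have [/existsP[r0 nr0]|/existsPn sur] := boolP [exists x, x \notin codom f]; last first.
  case: no_spanning_piece; apply: inj_card_bij => //.
  rewrite -(card_codom injf); apply: subset_leq_card; apply/subsetP => x _.
  by have := sur x; rewrite negbK.
pose R : finType := {x | x \notin codom f}.
pose g (u : R + 'I_(nverts P)) : T := match u with inl r => val r | inr a => f a end.
have injg : injective g.
  move=> [r|a] [s|b] //=; first by move/val_inj ->.
  - by move=> E; have := svalP r; rewrite E codom_f.
  - by move=> E; have := svalP s; rewrite -E codom_f.
  - by move/injf ->.
have bijg : bijective g.
  apply: inj_card_bij => //; rewrite card_sum card_sig -[#|'I__|](card_codom injf).
  by rewrite -(cardC (mem (codom f))) addnC; apply: leq_add; apply: subset_leq_card; apply/subsetP.
pose h u v := e (g u) (g v).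
have minh : minimal h by exact: (minimal_iso bijg (fun _ _ => erefl) mine).
have [lo hE] := glue_of minh wfP uP cubP hom (ex_intro _ (Sub r0 nr0 : R) I) k4.
exists R, (fun r s => h (inl r) (inl s)), lo; split; last exact: minimal_eq hE minh.
  by move=> r s; have [[symh _] _ _ _ _] := minh; exact: symh.
by move=> r; have [[_ irrh] _ _ _ _] := minh; exact: irrh.
Qed.

End Embedding.

Section Outer.
Variables (R : finType) (eR : rel R) (lo : nat -> R) (P : piece).
Hypotheses (symR : symmetric eR) (irrR : irreflexive eR) (gP : good_piece P).
Let k := arity P.
Let g := glue lo P eR (edges P) (iota 0 k).
Hypothesis ming : minimal g.

Lemma outer_deg r : deg eR r + count (fun i => lo i == r) (iota 0 k) = 3.
Proof.
case/and5P: gP => /andP[wP lP] uP _ _ _; have [_ cub _ _ _] := ming.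
by rewrite -(cub (inl r)) deg_glue_inl //; exact: uniq_legs.
Qed.

Lemma cut_pred1 r : cut eR (pred1 r) = deg eR r.
Proof.
rewrite /cut (bigD1 r) //= [X in _ + X]big1 ?addn0 => [|x /negbTE nx]; last first.
  by rewrite big1 // => y _; rewrite nx.
rewrite degE; apply: eq_bigr => y _; rewrite eqxx /=.
by case: (eqVneq y r) => [->|]; rewrite ?irrR.
Qed.

(** This is the cut around the piece together with [r]; the vertex [s] keeps its other side
    nonempty. *)
Lemma outer_count r s : s != r -> 3 <= deg eR r + count (fun i => lo i != r) (iota 0 k).
Proof.
move=> sr; case/and5P: gP => /andP[wP lP] uP _ _ _; have [_ _ c3 _ _] := ming.
have := c3 (fun u => if u is inl t then t == r else true) (ex_intro _ (inr ord0) isT) (ex_intro _ (inl s) sr).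
rewrite (cut_glue _ lP wP (uniq_legs lo uP) (b := fun=> true)) //.
have -> : count (fun p : nat * nat => true != true) (edges P) = 0 by elim: (edges P).
rewrite addn0 -cut_pred1 => /leq_trans -> //.
rewrite leq_add2l; apply: sub_count => i /=; by case: (lo i == r).
Qed.

End Outer.

(** * Exclusion of the six subgraphs *)

Definition cap (P : piece) : piece :=
  Piece (nverts P) (edges P ++ [seq (leg P i, nverts P) | i <- iota 0 (arity P)]) [::].

(** [star] may replace [P] only if the three outer ends differ. If two of them are the same vertex
    [w], at most two edges leave [P] together with [w]; so [w] is the only outer vertex and the
    graph is [cap P]. For the three pieces in question this is [K4], [K33] or the Petersen graph. *)
Lemma no_piece3 (T : finType) (e : rel T) (P : piece) (f : 'I_(nverts P) -> T) :
  minimal e -> injective f -> (forall a b, graph_of (edges P) a b -> e (f a) (f b)) ->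
  good_piece P -> arity P = 3 -> 0 < top P -> good_piece (cap P) ->
  reducible P star no_alts -> False.
Proof.
move=> mine injf hom gP k3 t0 gC red.
case/and5P: (gP) => wfP uP cubP k4 chk.
have [R [eR [lo [symR irrR ming]]]] := embed_glue mine hom wfP uP cubP chk injf k4.
have [/(uniqP (lo 0)) inj|dup] := boolP (uniq [seq lo i | i <- iota 0 (arity P)]).
  apply: (reduction symR irrR (Y := star) k3 wfP isT uP _ ming t0 isT cut_ok_star _ red) => //.
    split; first exact: iota_uniq.
    move=> i j; rewrite !mem_iota => /= ik jk lij _; apply: inj; rewrite ?inE ?size_map ?size_iota //.
    by rewrite !(nth_map 0) ?size_iota // !nth_iota.
  by move=> F _; exists [::].
have [w cw] : exists w, 2 <= count (fun i => lo i == w) (iota 0 (arity P)).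
  move: dup; rewrite k3 /= !inE !andbT negb_and !negbK -orbA.
  case/or3P=> /eqP E; [exists (lo 0)|exists (lo 0)|exists (lo 1)];
    by rewrite /= ?E ?eqxx; clear; lia.
have Rw r : r = w.
  apply/eqP/negPn/negP => rw; have := outer_count irrR gP ming rw.
  have := outer_deg gP ming w; have := count_predC (fun i => lo i == w) (iota 0 (arity P)).
  rewrite size_iota k3; move: cw; rewrite k3.
  rewrite (eq_count (a1 := predC _) (a2 := fun i => lo i != w)) //.
  by clear; lia.
case/and5P: gC => wfC uC cubC _ chkC.
pose fC (c : 'I_(nverts (cap P))) : R + 'I_(nverts P) := if c < nverts P then inr (inord c) else inl w.
apply: (no_spanning_piece (f := fC) ming _ wfC uC cubC chkC).
- have [[symg _] _ _ _ _] := ming.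
  suff one a b : (val a, val b) \in edges (cap P) ->
      glue lo P eR (edges P) (iota 0 (arity P)) (fC a) (fC b).
    by move=> a b /orP[/one|/one //]; rewrite symg.
  rewrite /= mem_cat /fC => /orP[abE|/mapP[i]].
    have /andP[/allP/(_ _ abE)/andP[/= -> ->] _] := proj1 (andP wfP).
    have /andP[/allP/(_ _ abE)/andP[/= an bn] _] := proj1 (andP wfP).
    by rewrite /= /graph_of /= !inordK // abE.
  rewrite mem_iota => /= ik [ai bn]; rewrite ai bn ltnn leg_lt ?(proj2 (andP wfP)) //=.
  by apply/hasP; exists i; rewrite ?mem_iota //= (Rw (lo i)) eqxx inordK ?leg_lt ?(proj2 (andP wfP)) /=.
- exists (fun u : R + 'I_(nverts P) => if u is inr a then inord (val a) else ord_max : 'I_(nverts (cap P))) => [c|[r|a]] /=; rewrite /fC.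
  + case: ifP => cn; apply: val_inj; rewrite /= ?inordK //.
    by have := ltn_ord c; move: cn => /negbT; rewrite -leqNgt /= ltnS => c1 c2; apply/eqP; rewrite eqn_leq c1 c2.
  + by rewrite /= ltnn (Rw r).
  + by rewrite inordK ?ltn_ord ?inord_val // ltnS ltnW.
Qed.

(** The legs of [square] sit at distinct vertices, so the smaller graph is simple even if outer ends
    coincide. *)
Lemma no_piece4 (T : finType) (e : rel T) (P : piece) (f : 'I_(nverts P) -> T) :
  minimal e -> injective f -> (forall a b, graph_of (edges P) a b -> e (f a) (f b)) ->
  good_piece P -> arity P = 4 -> 3 < top P -> reducible P square no_alts -> False.
Proof.
move=> mine injf hom /and5P[wfP uP cubP k4 chk] k t3 red.
have [R [eR [lo [symR irrR ming]]]] := embed_glue mine hom wfP uP cubP chk injf k4.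
apply: (reduction symR irrR (Y := square) k wfP isT uP _ ming t3 isT cut_ok_square _ red) => //.
  by rewrite k; exact: (@uniq_legs _ lo square).
by move=> F _; exists [::].
Qed.

Lemma good_triangle : good_piece triangle_piece. Proof. by vm_compute. Qed.
Lemma good_K23 : good_piece K23_piece. Proof. by vm_compute. Qed.
Lemma good_petersen : good_piece petersen_piece. Proof. by vm_compute. Qed.
Lemma good_claw_square : good_piece claw_square_piece. Proof. by vm_compute. Qed.
Lemma good_twin_house : good_piece twin_house_piece. Proof. by vm_compute. Qed.
Lemma good_domino : good_piece domino_piece. Proof. by vm_compute. Qed.
Lemma good_cap_triangle : good_piece (cap triangle_piece). Proof. by vm_compute. Qed.
Lemma good_cap_K23 : good_piece (cap K23_piece). Proof. by vm_compute. Qed.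
Lemma good_cap_petersen : good_piece (cap petersen_piece). Proof. by vm_compute. Qed.

(** The tree reaches the piece only by legs [i0] and [i1], so every outer vertex is joined outside
    to [lo i0] or [lo i1]. From the other side of [A] this needs the only edge across [A]; hence
    [lo i2] and [lo i3] reach the same end of it. *)
Lemma outer_connect (R : finType) (eR : rel R) (lo : nat -> R) (Y : piece) k
    (F : rel (R + 'I_(nverts Y))) (A : pred R) (b : bool) i0 i1 i2 i3 :
  let FR := fun r s => F (inl r) (inl s) in
  balanced_tree (glue lo Y eR (edges Y) (iota 0 k)) F ->
  (forall i, i < k -> F (inl (lo i)) (inr (inord (leg Y i))) -> i = i0 \/ i = i1) ->
  [/\ A (lo i0) = b, A (lo i1) = b, A (lo i2) = ~~ b & A (lo i3) = ~~ b] ->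
  symmetric eR -> cut eR A <= 1 ->
  connect FR (lo i2) (lo i3) /\ (connect FR (lo i2) (lo i0) \/ connect FR (lo i2) (lo i1)).
Proof.
move=> FR [sF subF cF _ _] legF [A0 A1 A2 A3] symR cutA.
have symFR : symmetric FR by move=> r s; exact: sF.
have reach x : connect FR x (lo i0) \/ connect FR x (lo i1).
  pose K (u : R + 'I_(nverts Y)) := if u is inl r then connect FR x r else false.
  have [u [v [_ Fv Ku]]] := connect_cross (A := K) (cF (inl x) (inr ord0)) (connect0 _ _) isT.
  case: u Fv Ku => [r|//] Fv Kr; case: v Fv => [s Frs|a Fra] /=.
    by case/negP; apply: connect_trans Kr (connect1 _).
  have /hasP[i] := subF _ _ Fra; rewrite mem_iota => /= ik /andP[/eqP ir /eqP ia] _.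
  have Fi : F (inl (lo i)) (inr (inord (leg Y i))) by rewrite ir ia inord_val.
  by case: (legF i ik Fi) => <-; rewrite ir; [left | right].
pose Q r := A r == ~~ b.
have cutQ : cut eR Q <= 1.
  apply: leq_trans cutA; rewrite /Q; case: (b); last by apply: eq_leq; rewrite /cut; do 2!(apply: eq_bigr => ? _); rewrite !eqb_id.
  rewrite -(cutC _ symR) /cut; apply: leq_sum => x _; apply: leq_sum => y _ /=.
  by case: (A x); case: (A y).
have cross x : Q x -> exists u v, [/\ connect FR x u, FR u v, Q u & ~~ Q v].
  move=> Qx; have [] := reach x => c; apply: connect_cross c Qx _; rewrite /Q ?A0 ?A1; by case: (b).
have [|u [v [cu Fuv Qu Qv]]] := cross (lo i2); first by rewrite /Q A2.
have [|u' [v' [cu' Fuv' Qu' Qv']]] := cross (lo i3); first by rewrite /Q A3.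
have subR r s : FR r s -> eR r s by exact: (subF (inl r) (inl s)).
have [E _] : (u, v) = (u', v').
  move: cutQ; rewrite cut_card => /card_le1_eqP; apply; rewrite inE.
    by apply/and3P; split=> //; exact: subR.
  by apply/and3P; split=> //; exact: subR.
split=> //; apply: connect_trans cu _; rewrite (sym_connect_sym symFR) E.
exact: cu'.
Qed.

Lemma no_domino_glue (R : finType) (eR : rel R) (lo : nat -> R) :
  symmetric eR -> irreflexive eR ->
  minimal (glue lo domino_piece eR (edges domino_piece) (iota 0 4)) -> False.
Proof.
move=> symR irrR ming.
have cut_eq (A B : pred R) : A =1 B -> cut eR A = cut eR B.
  by move=> AB; rewrite /cut; do 2!(apply: eq_bigr => ? _); rewrite !AB.
have [/existsP[A /andP[sA cA]]|/existsPn noA] :=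
  boolP [exists A : {set R}, (sides lo 4 (mem A) \in row_split) && (cut eR (mem A) <= 1)].
  apply: (reduction symR irrR (X := domino_piece) (Y := square) erefl isT isT isT _ ming isT isT cut_ok_square _ reducible_domino_square) => //.
    exact: (@uniq_legs _ lo square).
  move=> F tF; have [b [A0 A1 A2 A3]] : exists b,
      [/\ mem A (lo 0) = b, mem A (lo 1) = b, mem A (lo 2) = ~~ b & mem A (lo 3) = ~~ b].
    by move: sA; rewrite !inE => /orP[] /eqP[-> -> -> ->]; [exists true | exists false].
  set LY := [seq i <- _ | _].
  have LYP i : i < 4 -> F (inl (lo i)) (inr (inord (leg square i))) -> i \in LY.
    by move=> i4 Fi; rewrite mem_filter Fi mem_iota.
  rewrite /domino_alts; case: eqP => [E|_].
    have := outer_connect (i0 := 0) (i1 := 1) (i2 := 2) (i3 := 3) (A := mem A) tF _ (And4 A0 A1 A2 A3) symR cA.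
    case=> [i i4 /(LYP i i4)|c23 c2]; first by rewrite E !inE => /orP[] /eqP; [left|right].
    case: c2 => c2.
      exists [:: (2,3); (2,0)]; first exact: mem_head.
      by move=> p; rewrite in_cons mem_seq1 => /orP[] /eqP ->; split.
    exists [:: (2,3); (2,1)]; first by rewrite in_cons mem_head orbT.
    by move=> p; rewrite in_cons mem_seq1 => /orP[] /eqP ->; split.
  case: eqP => [E|_]; last by exists [::].
  have := outer_connect (i0 := 2) (i1 := 3) (i2 := 0) (i3 := 1) (A := mem A) (b := ~~ b) tF _ _ symR cA.
  rewrite negbK => /(_ _ (And4 A2 A3 A0 A1)).
  case=> [i i4 /(LYP i i4)|c01 c0]; first by rewrite E !inE => /orP[] /eqP; [left|right].
  case: c0 => c0.
    exists [:: (0,1); (0,2)]; first exact: mem_head.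
    by move=> p; rewrite in_cons mem_seq1 => /orP[] /eqP ->; split.
  exists [:: (0,1); (0,3)]; first by rewrite in_cons mem_head orbT.
  by move=> p; rewrite in_cons mem_seq1 => /orP[] /eqP ->; split.
have weakR (A : pred R) : sides lo 4 A \in row_split -> 2 <= cut eR A.
  move=> sA; have := noA [set r | A r]; rewrite negb_and -ltnNge.
  have AE : mem [set r | A r] =1 A by move=> r; rewrite /= inE.
  have -> : sides lo 4 (mem [set r | A r]) = sides lo 4 A by apply: eq_map => i; exact: AE.
  by rewrite sA (cut_eq _ _ AE).
(* A vertex that takes two legs has at most one outer edge, so by [weakR] it cannot split the rows
   by itself. *)
have twin w : 2 <= count (fun i => lo i == w) (iota 0 4) -> sides lo 4 (pred1 w) \notin row_split.
  move=> c2; apply/negP => /weakR; rewrite (cut_pred1 irrR).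
  have : deg eR w + count (fun i => lo i == w) (iota 0 4) = 3 := outer_deg good_domino ming w.
  by move: (deg _ _) (count _ _) c2; clear; lia.
(* Three legs at [w] leave no outer edge at [w] and at most one edge around the piece with [w]. If
   [w] is the only outer vertex, it takes all four legs, more than its degree. *)
have apart w : 3 <= count (fun i => lo i == w) (iota 0 4) -> False.
  move=> c3; have od : deg eR w + count (fun i => lo i == w) (iota 0 4) = 3 := outer_deg good_domino ming w.
  have [/existsP[s sw]|/existsPn all_w] := boolP [exists s, s != w].
    have : 3 <= deg eR w + count (fun i => lo i != w) (iota 0 4) := outer_count irrR good_domino ming sw.
    have := count_predC (fun i => lo i == w) (iota 0 4).
    rewrite size_iota (eq_count (a1 := predC _) (a2 := fun i => lo i != w)) //.
    by move: (deg _ _) (count _ _) (count _ _) c3 od; clear; lia.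
  have lw i : lo i = w by apply/eqP; rewrite -[_ == _]negbK.
  by move: od; rewrite (eq_count (a2 := predT)) ?count_predT ?size_iota => [|i]; rewrite ?lw ?eqxx //; move: (deg _ _); clear; lia.
apply: (reduction symR irrR (X := domino_piece) (Y := bar) erefl isT isT isT _ ming isT isT cut_ok_bar weakR reducible_domino_bar) => //; last by move=> F _; exists [::].
(* [bar] carries legs 0 and 1 at one vertex and legs 2 and 3 at the other, so these two pairs need
   distinct outer ends. *)
have n01 : lo 0 <> lo 1.
  move=> E; case e2 : (lo 2 == lo 0); first by case: (apart (lo 0)); rewrite /= -E !eqxx e2.
  case e3 : (lo 3 == lo 0); first by case: (apart (lo 0)); rewrite /= -E !eqxx e2 e3.
  by have := twin (lo 0); rewrite /sides /= -E !eqxx e2 e3 => /(_ isT).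
have n23 : lo 2 <> lo 3.
  move=> E; case e0 : (lo 0 == lo 2); first by case: (apart (lo 2)); rewrite /= -E !eqxx e0; case: (lo 1 == _).
  case e1 : (lo 1 == lo 2); first by case: (apart (lo 2)); rewrite /= -E !eqxx e0 e1.
  by have := twin (lo 2); rewrite /sides /= -E !eqxx e0 e1 => /(_ isT).
split; first exact: iota_uniq.
move=> i j; rewrite !mem_iota.
by case: i => [|[|[|[|//]]]] _; case: j => [|[|[|[|//]]]] _ //= E _;
  first [case: (n01 E) | case: (n01 (esym E)) | case: (n23 E) | case: (n23 (esym E))].
Qed.

Lemma no_domino_piece (T : finType) (e : rel T) (f : 'I_(nverts domino_piece) -> T) :
  minimal e -> injective f -> (forall a b, graph_of (edges domino_piece) a b -> e (f a) (f b)) ->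
  False.
Proof.
move=> mine injf hom; case/and5P: good_domino => wfP uP cubP k4 chk.
have [R [eR [lo [symR irrR ming]]]] := embed_glue mine hom wfP uP cubP chk injf k4.
exact: no_domino_glue symR irrR ming.
Qed.

(** * Induced paths and cycles *)

Section LocalStructure.
Variables (T : finType) (e : rel T).
Hypotheses (syme : symmetric e) (irre : irreflexive e) (cube : cubic e).

Lemma graph_of_seq n (E : seq (nat * nat)) (x0 : T) (s : seq T) :
  size s = n -> uniq s -> all (fun p => e (nth x0 s p.1) (nth x0 s p.2)) E ->
  has_subgraph (@graph_of n E) e.
Proof.
move=> sz us /allP sE; exists (fun i : 'I_n => nth x0 s i); split.
  by move=> i j /eqP; rewrite nth_uniq ?sz // => /eqP/val_inj.
by move=> i j /orP[/sE|/sE] //; rewrite syme.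
Qed.

Hypothesis no_triangle : ~ has_subgraph triangle e.

Lemma triangle_free x y z : e x y -> e y z -> e x z = false.
Proof.
move=> xy yz; apply/negP => xz; apply: no_triangle.
have neq u v : e u v -> u != v by move=> uv; apply/eqP => E; rewrite E irre in uv.
refine (@graph_of_seq 3 (edges triangle_piece) x [:: x; y; z] erefl _ _); last by rewrite /= xy yz syme xz.
by rewrite /= !inE !negb_or !neq.
Qed.

Lemma adj_neq u v : e u v -> u != v.
Proof. by move=> uv; apply/eqP => E; rewrite E irre in uv. Qed.

Lemma adj_neq_nonadj u v w : e u v -> e u w = false -> v != w.
Proof. by move=> uv uw; apply/eqP => E; rewrite E uw in uv. Qed.

(* The ends of a walk of length three are distinct, since otherwise it is a triangle. *)
Lemma walk3_neq u v w x : e u v -> e v w -> e w x -> u != x.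
Proof. by move=> uv vw wx; apply/eqP => E; move: (triangle_free uv vw); rewrite E syme wx. Qed.

Lemma cubic_nbrs v u : e v u -> exists p q,
  [/\ e v p, e v q, u != p, u != q & p != q] /\ forall z, e v z -> [|| z == u, z == p | z == q].
Proof.
move=> vu; pose N := [set w | e v w]; have Nu : u \in N by rewrite inE.
have : #|N :\ u| == 2 by have := cube v; rewrite /deg -/N (cardsD1 u) Nu add1n => -[->].
case/cards2P=> [p [q [pq NE]]]; exists p, q.
have /[!inE]/andP[pu vp] : p \in N :\ u by rewrite NE !inE eqxx.
have /[!inE]/andP[qu vq] : q \in N :\ u by rewrite NE !inE eqxx orbT.
split; first by rewrite ![u == _]eq_sym.
move=> z vz; have [//|zu] := eqVneq z u.
have : z \in N :\ u by rewrite !inE zu.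
by rewrite NE !inE.
Qed.

Lemma cubic_third v u t : e v u -> e v t -> t != u -> exists p,
  [/\ e v p, u != p & t != p] /\ forall z, e v z -> [|| z == u, z == t | z == p].
Proof.
move=> vu vt tu; have [p [q [[vp vq up uq pq] N]]] := cubic_nbrs vu.
have := N t vt; rewrite (negbTE tu) /= => /orP[] /eqP E; subst t.
  by exists q; split.
exists p; split; first by split=> //; rewrite eq_sym.
by move=> z /N; rewrite [(_ == p) || _]orbC.
Qed.

Ltac symmetrize := repeat match goal with
  | H : is_true (e ?u ?v) |- _ =>
    lazymatch goal with
    | _ : is_true (e v u) |- _ => fail
    | _ => have := H; rewrite syme => ?
    end
  end.

Ltac neq := solve [assumption | rewrite eq_sym; assumption |
  match goal with
  | H : is_true (e ?u ?v) |- is_true (?u != ?v) => exact: adj_neq H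
  | H1 : is_true (e ?u ?a), H2 : is_true (e ?a ?b), H3 : is_true (e ?b ?v)
      |- is_true (?u != ?v) => exact: walk3_neq H1 H2 H3
  end].

(** Adjacent vertices differ, and so do the ends of a walk of length three; what remains, such as
    vertices with a common neighbour, is assumed in the lemmas below. *)
Ltac distinct := symmetrize; rewrite /= !inE !negb_or -?andbA; repeat (apply/andP; split => //); neq.

Section Forbidden.
Hypotheses (noK23 : ~ has_subgraph K23 e)
  (no_petersen : ~ has_subgraph (@graph_of 9 (edges petersen_piece)) e)
  (no_claw_square : ~ has_subgraph claw_square e)
  (no_twin_house : ~ has_subgraph twin_house e)
  (no_domino : ~ has_subgraph domino e).

Lemma K23_free u v x y z : u != v -> x != y -> x != z -> y != z ->
  e u x -> e u y -> e u z -> e v x -> e v y -> e v z -> False.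
Proof.
move=> uv xy xz yz ux uy uz vx vy vz; apply: noK23.
refine (@graph_of_seq 5 (edges K23_piece) u [:: u; v; x; y; z] erefl _ _); last by rewrite /= ux uy uz vx vy vz.
distinct.
Qed.

(* The two 4-cycles share the edge [bf]; the corners [a], [c] are next to [b]. *)
Lemma domino_free b f a c d g : e b f -> e b a -> e b c -> e f d -> e f g ->
  a != c -> a != f -> c != f -> d != g -> d != b -> g != b -> e a d -> e c g -> False.
Proof.
move=> bf ba bc fd fg ac af cf dg db gb ad cg; apply: no_domino.
refine (@graph_of_seq 6 (edges domino_piece) a [:: a; b; c; d; f; g] erefl _ _); last by rewrite /= [e a b]syme [e d f]syme ba bc fd fg ad bf cg.
distinct.
Qed.

Lemma twin_house_free p1 p2 p5 p6 p3 p4 : e p1 p2 -> e p1 p5 -> e p2 p6 ->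
  p5 != p2 -> p6 != p1 -> p3 != p4 -> e p5 p3 -> e p5 p4 -> e p6 p3 -> e p6 p4 -> False.
Proof.
move=> e12 e15 e26 n52 n61 n34 e53 e54 e63 e64; apply: no_twin_house.
refine (@graph_of_seq 6 (edges twin_house_piece) p1 [:: p1; p2; p3; p4; p5; p6] erefl _ _); last by rewrite /= e12 e15 e26 e53 e54 e63 e64.
distinct.
Qed.

Lemma claw_square_free a1 a2 a3 a4 b1 b2 b3 c :
  e a1 a2 -> e a2 a3 -> e a3 a4 -> e a4 a1 -> e c b1 -> e c b2 -> e c b3 ->
  e b1 a1 -> e b2 a2 -> e b3 a3 -> a1 != a3 -> a2 != a4 -> b1 != b2 -> b1 != b3 -> b2 != b3 ->
  b1 != a4 -> b3 != a4 -> False.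
Proof.
move=> e12 e23 e34 e41 c1 c2 c3 f1 f2 f3 n13 n24 m12 m13 m23 k1 k3; apply: no_claw_square.
refine (@graph_of_seq 8 (edges claw_square_piece) a1 [:: a1; a2; a3; a4; b1; b2; b3; c] erefl _ _); last by rewrite /= e12 e23 e34 e41 c1 c2 c3 f1 f2 f3.
distinct.
Qed.


(** [w] plays the removed vertex of the Petersen graph, with neighbours [x], [a], [b]. *)
Lemma petersen_free w x a b c d p q c2 d2 :
  e w x -> e w a -> e w b -> e x c -> e x d -> e a p -> e a q -> e b c2 -> e b d2 ->
  e c p -> e c c2 -> e d q -> e d d2 -> e q c2 -> e p d2 ->
  x != a -> x != b -> a != b -> p != c2 -> p != q -> q != d2 -> c2 != d2 -> c != d ->
  x != p -> x != c2 -> x != q -> x != d2 ->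
  c != d2 -> a != d2 -> a != c2 -> b != p -> b != q -> c != q -> d != p -> d != c2 -> False.
Proof.
move=> *; apply: no_petersen.
refine (@graph_of_seq 9 _ x [:: x; c; p; a; b; d; c2; d2; q] erefl _ _); last first.
  rewrite /=.
  by symmetrize; repeat (apply/andP; split).
distinct.
Qed.

(** * Induced paths with a given middle edge *)

Definition mid_path (w x : T) : Prop :=
  exists v : 'I_6 -> T, induced_path e v /\
    ((v (inord 2) = w /\ v (inord 3) = x) \/ (v (inord 2) = x /\ v (inord 3) = w)).

(** Distinctness follows from the adjacencies: two equal vertices would have the same neighbours. *)
Lemma induced_path6 (s : seq T) v0 v1 v2 v3 v4 v5 : s = [:: v0; v1; v2; v3; v4; v5] ->
  e v0 v1 -> e v1 v2 -> e v2 v3 -> e v3 v4 -> e v4 v5 ->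
  e v0 v2 = false -> e v0 v3 = false -> e v0 v4 = false -> e v0 v5 = false ->
  e v1 v3 = false -> e v1 v4 = false -> e v1 v5 = false -> e v2 v4 = false -> e v2 v5 = false ->
  e v3 v5 = false -> induced_path e (fun i : 'I_6 => nth v0 s i).
Proof.
move=> -> e01 e12 e23 e34 e45 n02 n03 n04 n05 n13 n14 n15 n24 n25 n35; split.
  have us : uniq [:: v0; v1; v2; v3; v4; v5].
    rewrite /= !inE !negb_or -?andbA; repeat (apply/andP; split => //);
    first [exact: adj_neq | apply/eqP => E; subst;
      match goal with
      | H : is_true (e ?u ?v), K : e ?u ?v = false |- _ => by rewrite H in K
      | H : is_true (e ?u ?v), K : e ?v ?u = false |- _ => by rewrite syme H in K
      end].
  by move=> i j /eqP; rewrite nth_uniq // => /eqP/val_inj.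
move=> i j; rewrite [in RHS]/val /=; case: i j => [[|[|[|[|[|[|//]]]]]] ?] [[|[|[|[|[|[|//]]]]]] ?] //=;
  rewrite ?irre // ; first [by [] | by rewrite syme].
Qed.

(** The second alternative lists the chords that can spoil the path [v1 a w x c v6]; the others
    close triangles, apart from [a c], which is assumed absent. The choices [v1 = w] and [v6 = x]
    are covered by the chords [v1 x] and [w v6]. *)
Lemma mid_path_or w x : e w x -> mid_path w x \/
  (forall a c v1 v6, e w a -> e x c -> e a v1 -> e c v6 -> e a c = false ->
     [|| e v1 x, e v1 c, e v1 v6, e a v6 | e w v6]).
Proof.
move=> wx; pose ok (a c v1 v6 : T) := [&& e w a, e x c, e a v1, e c v6 & ~~ e a c] ==>
  [|| e v1 x, e v1 c, e v1 v6, e a v6 | e w v6].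
have [H|] := boolP [forall a, forall c, forall v1, forall v6, ok a c v1 v6].
  right=> a c v1 v6 wa xc av cv ac.
  by have := forallP (forallP (forallP (forallP H a) c) v1) v6; rewrite /ok wa xc av cv ac.
rewrite negb_forall => /existsP[a]; rewrite negb_forall => /existsP[c].
rewrite negb_forall => /existsP[v1]; rewrite negb_forall => /existsP[v6].
rewrite /ok negb_imply !negb_or => /andP[/and5P[wa xc av cv /negbTE ac]].
case/and5P=> /negbTE n1 /negbTE n2 /negbTE n3 /negbTE n4 /negbTE n5; left.
exists (fun i : 'I_6 => nth v1 [:: v1; a; w; x; c; v6] i); split; last first.
  by left; rewrite !inordK.
have va : e v1 a by rewrite syme.
have aw : e a w by rewrite syme.
apply: (induced_path6 (v0 := v1) (v1 := a) (v2 := w) (v3 := x) (v4 := c) (v5 := v6) erefl) => //.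
- exact: triangle_free va aw.
- exact: triangle_free aw wx.
- exact: triangle_free wx xc.
- exact: triangle_free xc cv.
Qed.

Section MiddleEdge.
Variables w x : T.
Hypothesis wx : e w x.
Hypothesis path_fails : forall a c v1 v6,
  e w a -> e x c -> e a v1 -> e c v6 -> e a c = false ->
  [|| e v1 x, e v1 c, e v1 v6, e a v6 | e w v6].

(** Only the chords [v c], [v u] and [a u] can spoil the path [v a w x c u]. If [a] and [c] had no
    common neighbour, their further neighbours would all be joined crosswise, giving a [K23]
    together with [a]. Two common neighbours would give a twin-house; so there is just one, [p], and
    the remaining [q] and [r] are adjacent. *)
Lemma far_ends a c : e w a -> e x c -> e a c = false ->
  (forall v, e a v -> v != w -> e v x = false) -> (forall v, e c v -> v != x -> e v w = false) ->
  exists p q r,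
    [/\ [/\ e a p, e a q, e c p, e c r & e q r], [/\ w != p, w != q & p != q],
        [/\ x != p, x != r & p != r],
        forall z, e a z -> [|| z == w, z == p | z == q] &
        forall z, e c z -> [|| z == x, z == p | z == r]].
Proof.
move=> wa xc ac farA farC.
have aw : e a w by rewrite syme. have cx : e c x by rewrite syme.
have cw : e c w = false by apply: triangle_free cx _; rewrite syme.
have ax : e a x = false by apply: triangle_free aw wx.
have [a1 [a2 [[aa1 aa2 wa1 wa2 a12] Na]]] := cubic_nbrs aw.
have [c1 [c2 [[cc1 cc2 xc1 xc2 c12] Nc]]] := cubic_nbrs cx.
have clash v u : e a v -> w != v -> e c u -> x != u -> [|| e v c, e v u | e a u].
  move=> av wv cu xu; have := path_fails wa xc av cu ac.
  by rewrite farA 1?eq_sym // [e w u]syme farC 1?eq_sym // orbF.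
have outC v : e a v -> v != c1 -> v != c2 -> e v c = false.
  move=> av n1 n2; apply/negP; rewrite syme => /Nc; rewrite (negbTE n1) (negbTE n2) !orbF => /eqP E.
  by rewrite E ax in av.
have outA u : e c u -> u != a1 -> u != a2 -> e a u = false.
  move=> cu n1 n2; apply/negP => /Na; rewrite (negbTE n1) (negbTE n2) !orbF => /eqP E.
  by rewrite E cw in cu.
have common p q r : e a p -> e a q -> e c p -> e c r -> w != p -> w != q -> p != q ->
    x != p -> x != r -> p != r ->
    (forall z, e a z -> [|| z == w, z == p | z == q]) ->
    (forall z, e c z -> [|| z == x, z == p | z == r]) -> e q r.
  move=> ap aq cp cr wp wq pq xp xr pr Na' Nc'.
  have qc : e q c = false.
    apply/negP; rewrite syme => /Nc' /or3P[] /eqP E.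
    + by rewrite E ax in aq.
    + by rewrite E eqxx in pq.
    + have nax : a != x by apply/eqP => E'; rewrite E' xc in ac.
      have ncw : c != w by apply/eqP => E'; rewrite E' aw in ac.
      by rewrite -E in cr; exact: (twin_house_free wx wa xc nax ncw pq).
  have := clash q r aq wq cr xr; rewrite qc /= => /orP[//|/Na' /or3P[] /eqP E].
  - by rewrite E cw in cr.
  - by rewrite E eqxx in pr.
  - by rewrite -E syme cr in qc.
have swap (u p q z : T) : [|| z == u, z == p | z == q] -> [|| z == u, z == q | z == p].
  by rewrite [(_ == p) || _]orbC.
have [E|n11] := eqVneq a1 c1.
  by subst c1; exists a1, a2, c2; split=> //; split=> //; apply: (common a1).
have [E|n12] := eqVneq a1 c2.
  subst c2; have Nc' z cz := swap _ _ _ _ (Nc z cz).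
  by exists a1, a2, c1; split=> //; split=> //; rewrite 1?eq_sym //; apply: (common a1) => //; rewrite eq_sym.
have [E|n21] := eqVneq a2 c1.
  subst c1; have Na' z az := swap _ _ _ _ (Na z az).
  by exists a2, a1, c2; split=> //; split=> //; rewrite 1?eq_sym //; apply: (common a2) => //; rewrite eq_sym.
have [E|n22] := eqVneq a2 c2.
  subst c2; have Na' z az := swap _ _ _ _ (Na z az); have Nc' z cz := swap _ _ _ _ (Nc z cz).
  by exists a2, a1, c1; split=> //; split=> //; rewrite 1?eq_sym //; apply: (common a2) => //; rewrite eq_sym.
have full u v : e a u -> w != u -> u != c1 -> u != c2 -> e c v -> x != v -> v != a1 -> v != a2 -> e u v.
  move=> au wu u1 u2 cv xv v1 v2.
  by have := clash u v au wu cv xv; rewrite outC // outA // orbF.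
case: (@K23_free a1 a2 c1 c2 a) => //; rewrite ?(syme _ a) //.
- by apply/eqP => E; rewrite E syme ac in cc1.
- by apply/eqP => E; rewrite E syme ac in cc2.
- by apply: full; rewrite // eq_sym.
- by apply: full; rewrite // eq_sym.
- by apply: full; rewrite // eq_sym.
- by apply: full; rewrite // eq_sym.
Qed.


Lemma or3_eq (z u p q : T) : [|| z == u, z == p | z == q] -> u != z -> (z == p) || (z == q).
Proof. by rewrite [u == z]eq_sym => /orP[->|]. Qed.

(** [far_ends] applies to each of [a], [b] paired with each of [c], [d]. If the common neighbours
    for [a c] and [a d], or for [a c] and [b c], coincide, a claw-square appears; otherwise all
    further adjacencies are forced and give the Petersen graph without [w]. *)
Lemma no_square_at_edge :
  (forall a c, e w a -> a != x -> e x c -> c != w -> e a c = false) -> False.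
Proof.
move=> noAdj; have xw : e x w by rewrite syme.
have [a [b [[wa wb xa xb ab] Nw]]] := cubic_nbrs wx.
have [c [d [[xc xd wc wd cd] Nx]]] := cubic_nbrs xw.
have far1 u : e w u -> x != u -> forall v, e u v -> v != w -> e v x = false.
  move=> wu xu v uv vw; apply/negP => vx.
  by have := noAdj u v wu; rewrite uv [u == x]eq_sym [e x v]syme vx => /(_ xu isT vw).
have far2 u : e x u -> w != u -> forall v, e u v -> v != x -> e v w = false.
  move=> xu wu v uv vx; apply/negP => vw.
  by have := noAdj v u; rewrite [e w v]syme [e v u]syme uv vw [u == w]eq_sym => /(_ isT vx xu wu).
have adj u v : e w u -> x != u -> e x v -> w != v -> e u v = false.
  by move=> *; apply: noAdj => //; rewrite eq_sym.
have fe u v (wu : e w u) (xu : x != u) (xv : e x v) (wv : w != v) :=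
  far_ends wu xv (adj u v wu xu xv wv) (far1 u wu xu) (far2 v xv wv).
have [p [q [c2 [[ap aq cp cc2 qc2] [wp wq pq] [xp xc2 pc2] Na Nc]]]] := fe a c wa xa xc wc.
have [p' [q' [d2 [[ap' aq' dp' dd2 q'd2] [wp' wq' pq'] [xp' xd2 pd2'] _ Nd]]]] := fe a d wa xa xd wd.
have [r [b2 [c2' [[br bb2 cr cc2' b2c2'] [wr wb2 rb2] [xr xc2' rc2'] Nb _]]]] := fe b c wb xb xc wc.
(* If [p' = p] and [c2 = d2], then [c] and [d] share the neighbours [x], [p] and [d2]. *)
have cd2 : c2 != d2 \/ p' <> p.
  have [E|/eqP ?] := eqVneq p' p; last by right.
  left; apply/eqP => E2; subst.
  by apply: (@K23_free c d x p d2) => //; rewrite syme.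
have pc : e p c by rewrite syme. have pa : e p a by rewrite syme.
have [E|/eqP p'p] := eqVneq p' p.
  have Eq : q' = q by case/orP: (or3_eq (Na _ aq') wq') => /eqP // E'; rewrite E E' eqxx in pq'.
  subst p' q'; case: cd2 => // cd2.
  (* The 4-cycle is [c p d x]; the centre [q] is joined to it by way of [c2], [a] and [d2]. *)
  apply: (@claw_square_free c p d x c2 a d2 q); rewrite // 1?syme //.
  - by rewrite eq_sym.
  - by apply/eqP => E'; rewrite E' syme (adj a c) in cc2.
  - by apply/eqP => E'; rewrite -E' syme (adj a d) in dd2.
  - by rewrite eq_sym.
  - by rewrite eq_sym.
have Ep : p' = q by case/orP: (or3_eq (Na _ ap') wp') => /eqP.
have Eq : q' = p by case/orP: (or3_eq (Na _ aq') wq') => /eqP // E'; rewrite Ep E' eqxx in pq'.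
subst p' q'.
have [E|/eqP rp] := eqVneq r p.
  have E' : c2' = c2 by case/orP: (or3_eq (Nc _ cc2') xc2') => /eqP // E'; rewrite E E' eqxx in rc2'.
  subst r c2'.
  have qb2 : q != b2.
    apply/eqP => E2; subst b2.
    by apply: (@K23_free a b w p q) => //; rewrite syme.
  apply: (@claw_square_free a p b w q c b2 c2); rewrite // 1?syme //.
  - by rewrite eq_sym.
  - by apply/eqP => E'; rewrite E' (adj a c) in aq.
  - by apply/eqP => E'; rewrite -E' (adj b c) in bb2.
  - by rewrite eq_sym.
  - by rewrite eq_sym.
have Er : r = c2 by case/orP: (or3_eq (Nc _ cr) xr) => /eqP.
have Ec2' : c2' = p by case/orP: (or3_eq (Nc _ cc2') xc2') => /eqP // E'; rewrite Er E' eqxx in rc2'.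
subst r c2'.
have [s [b2' [d2' [[bs bb2' ds dd2' b2d2'] [ws wb2' sb2'] [xs xd2' sd2'] _ _]]]] := fe b d wb xb xd wd.
have c2c : e c2 c by rewrite syme.
have sd2 : s = d2.
  case/orP: (or3_eq (Nd _ ds) xs) => /eqP E //; subst s.
  case/orP: (or3_eq (Nb _ bs) ws) => /eqP E.
    by rewrite E irre in qc2.
  by subst b2; have := triangle_free pa aq; rewrite syme b2c2'.
subst s.
case/orP: (or3_eq (Nb _ bs) ws) => /eqP E.
  by subst d2; have := triangle_free pc cc2; rewrite q'd2.
subst b2.
have nac : e a c = false by exact: adj. have nad : e a d = false by exact: adj.
have nbc : e b c = false by exact: adj. have nbd : e b d = false by exact: adj.
have nca : e c a = false by rewrite syme. have nda : e d a = false by rewrite syme.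
have ncb : e c b = false by rewrite syme. have ndb : e d b = false by rewrite syme.
apply: (@petersen_free w x a b c d p q c2 d2) => //; rewrite eq_sym.
- exact: adj_neq_nonadj bs nbc.
- exact: adj_neq_nonadj dd2 nda.
- exact: adj_neq_nonadj cc2 nca.
- exact: adj_neq_nonadj cp ncb.
- exact: adj_neq_nonadj dp' ndb.
- exact: adj_neq_nonadj aq nac.
- exact: adj_neq_nonadj ap nad.
- exact: adj_neq_nonadj br nbd.
Qed.

(** The domino and [K23] exclude the adjacencies [b c], [a c], [b d] and [a1 d1] around the 4-cycle
    [w a d x]. The failure of the paths through [a w x c] and [b w x d] forces [a1 c] and [d1 b],
    the alternative being a twin-house. Hence [a1 = r] and [d1 = q], and these are adjacent. *)
Lemma square_at_edge a d : e w a -> a != x -> e x d -> d != w -> e a d -> False.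
Proof.
move=> wa ax xd dw ad; have xw : e x w by rewrite syme.
have aw : e a w by rewrite syme. have dx : e d x by rewrite syme. have da : e d a by rewrite syme.
have [b [[wb xb ab] Nw]] := cubic_third wx wa ax.
have [c [[xc wc dc] Nx]] := cubic_third xw xd dw.
have bc : e b c = false.
  apply/negP => bc; apply: (@domino_free w x a b d c) => //.
  - by rewrite eq_sym.
  - by rewrite eq_sym.
have ac : e a c = false.
  by apply/negP => ac; apply: (@K23_free a x w d c); rewrite // eq_sym.
have bd : e b d = false.
  apply/negP => bd; apply: (@K23_free d w a x b); rewrite // 1?eq_sym //.
  by rewrite syme.
have [a1 [[aa1 wa1 da1] Na]] := cubic_third aw ad dw.
have [d1 [[dd1 xd1 ad1] Nd]] := cubic_third dx da ax.
have a1d1 : e a1 d1 = false.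
  by apply/negP => H; apply: (@domino_free a d w a1 x d1); rewrite // 1?eq_sym.
have cx : e c x by rewrite syme. have bw : e b w by rewrite syme.
have ax0 : e a x = false by exact: triangle_free aw wx.
have cw0 : e c w = false by exact: triangle_free cx xw.
have dw0 : e d w = false by exact: triangle_free dx xw.
have bx0 : e b x = false by exact: triangle_free bw wx.
have farB v : e b v -> v != w -> e v x = false.
  move=> bv vw; apply/negP; rewrite syme => /Nx; rewrite (negbTE vw) /= => /orP[] /eqP E.
    by rewrite E bd in bv.
  by rewrite E bc in bv.
have farC v : e c v -> v != x -> e v w = false.
  move=> cv vx; apply/negP; rewrite syme => /Nw; rewrite (negbTE vx) /= => /orP[] /eqP E.
    by rewrite E syme ac in cv.
  by rewrite E syme bc in cv.
have [p [q [r [[bp bq cp cr qr] [wp wq pq] [xp xr pr] Nb Nc]]]] := far_ends wb xc bc farB farC.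
have alt_a : e a1 c \/ (e a1 p /\ e a1 r).
  have [|a1c] := boolP (e a1 c); [by left | right].
  have key v : e c v -> x != v -> e a1 v.
    move=> cv xv; have := path_fails wa xc aa1 cv ac; rewrite (negbTE a1c) /=.
    rewrite [e w v]syme farC 1?eq_sym // orbF => /orP[|/orP[//|/Na]].
      rewrite syme => /Nx /or3P[] /eqP E.
      + by rewrite E eqxx in wa1.
      + by rewrite E eqxx in da1.
      + by rewrite E ac in aa1.
    case/or3P=> /eqP E.
    + by rewrite E cw0 in cv.
    + by have := triangle_free dx xc; rewrite syme -E cv.
    + by rewrite E syme (negbTE a1c) in cv.
  by split; apply: key.
have alt_d : e d1 b \/ (e d1 p /\ e d1 q).
  have [|d1b] := boolP (e d1 b); [by left | right].
  have key v : e b v -> w != v -> e d1 v.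
    move=> bv wv; have := path_fails wb xd bv dd1 bd; rewrite [e v d1]syme [e b d1]syme (negbTE d1b) /=.
    rewrite farB 1?eq_sym //= => /or3P[|//|].
      rewrite syme => /Nd /or3P[] /eqP E.
      + by rewrite E bx0 in bv.
      + by have := triangle_free aw wb; rewrite syme -E bv.
      + by rewrite E syme (negbTE d1b) in bv.
    move/Nw=> /or3P[] /eqP E.
    + by rewrite E eqxx in xd1.
    + by rewrite E eqxx in ad1.
    + by rewrite E syme bd in dd1.
  by split; apply: key.
case: alt_a => [a1c|[a1p a1r]]; last first.
  apply: (@twin_house_free b q p r c a1) => //; rewrite 1?eq_sym // 1?syme //.
  - by apply/eqP => E; rewrite -E syme bc in cr.
  - exact: adj_neq_nonadj aa1 ac.
case: alt_d => [d1b|[d1p d1q]]; last first.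
  apply: (@twin_house_free c r p q b d1) => //; rewrite 1?eq_sym // 1?syme //.
  - by apply/eqP => E; rewrite -E bc in bq.
  - by apply: adj_neq_nonadj dd1 _; rewrite syme.
have a1r : a1 = r.
  have ca1 : e c a1 by rewrite syme.
  case/or3P: (Nc _ ca1) => /eqP E.
  - by rewrite E ax0 in aa1.
  - subst a1; exfalso; apply: (@domino_free w a x b d p); rewrite // 1?eq_sym //.
  - by [].
have d1q : d1 = q.
  have bd1 : e b d1 by rewrite syme.
  case/or3P: (Nb _ bd1) => /eqP E.
  - by rewrite E dw0 in dd1.
  - subst d1; exfalso; apply: (@domino_free x d w c a p); rewrite // 1?eq_sym //.
  - by [].
by subst a1 d1; rewrite syme qr in a1d1.
Qed.

End MiddleEdge.

Lemma mid_path_exists w x : e w x -> mid_path w x.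
Proof.
move=> wx; have [//|pf] := mid_path_or wx.
have [/existsP[a /existsP[d /and5P[wa ax xd dw ad]]]|H] :=
  boolP [exists a, exists d, [&& e w a, a != x, e x d, d != w & e a d]].
  by case: (square_at_edge wx pf wa ax xd dw ad).
case: (no_square_at_edge wx pf) => a c wa ax xc cw; apply: contraNF H => ac.
by apply/existsP; exists a; apply/existsP; exists c; rewrite wa ax xc cw ac.
Qed.

(** A chord closes a triangle unless it joins opposite vertices of a 6-cycle, where it makes a
    domino. *)
Lemma short_cycle_induced s : is_cycle e s -> size s \in [:: 4; 5; 6] -> induced_cycle e s.
Proof.
move=> [s3 us cs] s456 x y xs ys xy; have [i s' ds] := rot_to xs.
rewrite -!(next_rot i us) ds; rewrite -(mem_rot i) ds in ys.
have := cs; rewrite -(rot_cycle i) ds; have := us; rewrite -(rot_uniq i) ds.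
have : size (x :: s') \in [:: 4; 5; 6] by rewrite -ds size_rot.
have tri := triangle_free.
case: s' ys {ds} => [|b [|c [|d [|f [|g [|h s']]]]]] //= ys _; move: ys;
  rewrite !inE !negb_or -!andbA.
- move=> ys /and5P[xb xc xd bc /and3P[bd cd _]] /and5P[e1 e2 e3 e4 _].
  case/or4P: ys xy => /eqP-> xy; rewrite ?eqxx ?orbT //; first by rewrite irre in xy.
    by rewrite (tri _ _ _ e1 e2) in xy.
  by rewrite ![d == _]eq_sym (negbTE xd) (negbTE bd) (negbTE cd) eqxx orbT.
- move=> ys /and5P[xb xc xd xf /and5P[bc bd bf cd /and3P[cf df _]]] /and5P[e1 e2 e3 e4 /andP[e5 _]].
  move: ys xy => /or4P[|||/orP[]] /eqP-> xy; rewrite ?eqxx ?orbT //; first by rewrite irre in xy.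
  + by rewrite (tri _ _ _ e1 e2) in xy.
  + by rewrite syme (tri _ _ _ e4 e5) in xy.
  + by rewrite ![f == _]eq_sym (negbTE xf) (negbTE bf) (negbTE cf) (negbTE df) eqxx orbT.
- move=> ys /and5P[xb xc xd xf /and5P[xg bc bd bf /and5P[bg cd cf cg /and4P[df dg fg _]]]].
  move=> /and5P[e1 e2 e3 e4 /and3P[e5 e6 _]].
  move: ys xy => /or4P[|||/or3P[]] /eqP-> xy; rewrite ?eqxx ?orbT //; first by rewrite irre in xy.
  + by rewrite (tri _ _ _ e1 e2) in xy.
  + by case: (@domino_free x d b g c f); rewrite // 1?eq_sym // 1?syme.
  + by rewrite syme (tri _ _ _ e5 e6) in xy.
  + by rewrite ![g == _]eq_sym (negbTE xg) (negbTE bg) (negbTE cg) (negbTE dg) (negbTE fg) eqxx orbT.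
Qed.

End Forbidden.
End LocalStructure.

Lemma petersen_pieceE (a b : 'I_9) :
  graph_of (edges petersen_piece) a b -> petersen_minus_vertex a b.
Proof.
by case: a b => [[|[|[|[|[|[|[|[|[|//]]]]]]]]] ?] [[|[|[|[|[|[|[|[|[|//]]]]]]]]] ?].
Qed.

Theorem theorem7 (T : finType) (e : rel T)
  (Hsimple : simple_graph e) (Hcub : cubic e) (H3c : k_connected 3 e)
  (Hnodec : ~ three_decomposition e)
  (Hmin : forall (U : finType) (h : rel U), simple_graph h -> cubic h ->
            k_connected 3 h -> #|U| < #|T| -> three_decomposition h) :
  [/\ ~ has_subgraph triangle e,
      ~ has_subgraph K23 e &
      ~ has_subgraph petersen_minus_vertex e]
  /\ [/\ ~ has_subgraph claw_square e,
      ~ has_subgraph twin_house e &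
      ~ has_subgraph domino e]
  /\ (forall s : seq T, is_cycle e s -> 4 <= size s)
  /\ (forall s : seq T, is_cycle e s -> size s \in [:: 4; 5; 6] -> induced_cycle e s)
  /\ (forall w x : T, e w x ->
        exists v : 'I_6 -> T, induced_path e v /\
          ((v (inord 2) = w /\ v (inord 3) = x) \/ (v (inord 2) = x /\ v (inord 3) = w))).
Proof.
have T0 : 0 < #|T| by case: H3c => H _; exact: leq_trans H.
have mine : minimal e.
  split=> //; first exact: k_connected_cut3.
    by move/(three_decompositionP Hsimple Hcub T0).
  move=> U h sh ch c3 U0 UT.
  by apply/(three_decompositionP sh ch U0)/Hmin => //; exact: cut3_k_connected.
have no3 : ~ has_subgraph triangle e.
  by case=> f [injf hom]; exact: (@no_piece3 _ _ triangle_piece f mine injf hom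
    good_triangle erefl isT good_cap_triangle reducible_triangle).
have no23 : ~ has_subgraph K23 e.
  by case=> f [injf hom]; exact: (@no_piece3 _ _ K23_piece f mine injf hom
    good_K23 erefl isT good_cap_K23 reducible_K23).
have noP : ~ has_subgraph (@graph_of 9 (edges petersen_piece)) e.
  by case=> f [injf hom]; exact: (@no_piece3 _ _ petersen_piece f mine injf hom
    good_petersen erefl isT good_cap_petersen reducible_petersen).
have noC : ~ has_subgraph claw_square e.
  by case=> f [injf hom]; exact: (@no_piece4 _ _ claw_square_piece f mine injf hom
    good_claw_square erefl isT reducible_claw_square).
have noT : ~ has_subgraph twin_house e.
  by case=> f [injf hom]; exact: (@no_piece4 _ _ twin_house_piece f mine injf hom
    good_twin_house erefl isT reducible_twin_house).
have noD : ~ has_subgraph domino e.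
  by case=> f [injf hom]; exact: (no_domino_piece mine injf hom).
have [syme irre] := Hsimple.
split; [split=> // | split; [by split | split; [|split]]].
- by case=> f [injf hom]; apply: noP; exists f; split=> // a b /petersen_pieceE/hom.
- move=> s [s3 us cs]; rewrite ltn_neqAle s3 andbT; apply/eqP => s3'.
  move: us cs; case: s s3' {s3} => [|x [|y [|z [|? ?]]]] //= _ _.
  case/and4P=> xy yz zx _; have := triangle_free syme irre no3 xy yz.
  by rewrite syme zx.
- exact: short_cycle_induced.
- exact: mid_path_exists.
Qed.
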